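(* Let $1\le i\le d-1$ and let $\Sigma\subset\mathrm{GL}(d,\mathbb{R})$ be a compact set that is dominated of index $i$. Then: (i) There exists a non-empty subset $C\subset G(i,d)$ that is strictly invariant by $\Sigma$, such that there is a $(d-i)$-plane transverse to all elements of $C$, and such that $C$ has finitely many connected components, whose closures (in $G(i,d)$) are pairwise disjoint. (ii) There exists a subset $C'\subset P\mathbb{R}^d$ that is strictly invariant by $\Sigma$, that contains the projection $PE$ of some $i$-plane $E$, that does not intersect the projection $PF$ of some $(d-i)$-plane $F$, and that has finitely many connected components, whose closures (in $P\mathbb{R}^d$) are pairwise disjoint.
   Context: The singular values $\sigma_1(M)\ge\cdots\ge\sigma_d(M)$ of a $d\times d$ matrix $M$ are the eigenvalues of $(M^*M)^{1/2}$. A compact set $\Sigma\subset\mathrm{GL}(d,\mathbb{R})$ is dominated of index $i$ iff there exist $C>0$ and $0<\tau<1$ such that for any finite sequence $A_1,\ldots,A_N$ in $\Sigma$, $$\frac{\sigma_{i+1}(A_1\cdots A_N)}{\sigma_i(A_1\cdots A_N)}<C\tau^N.$$ An $i$-plane is an $i$-dimensional vector subspace of $\mathbb{R}^d$; $G(i,d)$ is the Grassmannian of $i$-planes with its usual topology, on which $\mathrm{GL}(d,\mathbb{R})$ acts naturally; $P\mathbb{R}^d=G(1,d)$. For a subspace $E$ of $\mathbb{R}^d$, $PE\subset P\mathbb{R}^d$ is the set of directions contained in $E$. An $i$-plane and a $(d-i)$-plane are transverse if they intersect only at $0$. For $C\subset G(k,d)$ (in particular for $k=i$ and $k=1$), $\Sigma^*C=\{A\cdot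 E : A\in\Sigma,\ E\in C\}$, and $C$ is strictly invariant by $\Sigma$ if the closure of $\Sigma^*C$ is included in the interior of $C$. *)

(* Defs.v *)
From HB Require Import structures.
From mathcomp Require Import all_boot all_order all_algebra.
From mathcomp Require Import all_classical all_reals all_analysis.
Set Implicit Arguments.
Unset Strict Implicit.
Unset Printing Implicit Defensive.
Import Order.TTheory GRing.Theory Num.Theory.
Import numFieldNormedType.Exports.
Local Open Scope classical_set_scope.
Local Open Scope ring_scope.

Section SingularValues.
Context {R : realType} {d : nat}.
Implicit Types (M S : 'M[R]_d) (s : seq R).

Definition psd S : Prop :=
  S^T = S /\ forall x : 'cV[R]_d, 0 <= (x^T *m S *m x) 0 0.

(* The unique positive semidefinite square root of a positive semidefinite
   matrix. *)
Definition psd_sqrt M : 'M[R]_d := xget 0 [set S | psd S /\ S *m S = M].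

Definition is_eigenvalues M s : Prop :=
  sorted >=%R s /\ char_poly M = \prod_(x <- s) ('X - x%:P).

(* Eigenvalues with algebraic multiplicity, in non-increasing order; meaningful
   when the characteristic polynomial splits over R, for instance when M is
   symmetric. *)
Definition eigenvalues M : seq R := xget [::] [set s | is_eigenvalues M s].

(* The index k starts at 1: k = 1 gives the largest singular value. *)
Definition singular_value (k : nat) M : R :=
  nth 0 (eigenvalues (psd_sqrt (M^T *m M))) k.-1.

Definition dominated (i : nat) (Sigma : set 'M[R]_d) : Prop :=
  exists C tau : R, [/\ 0 < C, 0 < tau < 1 &
    forall (N : nat) (A : 'I_N -> 'M[R]_d), (0 < N)%N ->
      (forall k, Sigma (A k)) ->
      let P := \prod_(k < N) A k in
      singular_value i.+1 P / singular_value i P < C * tau ^+ N].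

End SingularValues.

Section Grassmannian.
Context {R : realType} {i d : nat}.

Definition frames : set 'M[R]_(d, i) :=
  [set M | free [seq col j M | j <- enum 'I_i]].

Definition column_span (M : frames) : {vspace 'cV[R]_d} :=
  <<[seq col j (set_val M) | j <- enum 'I_i]>>%VS.

Lemma dim_column_span (M : frames) : \dim (column_span M) == i.
Proof.
have := set_valP M; rewrite /frames/= /free => /eqP ->.
by rewrite size_map size_enum_ord.
Qed.

End Grassmannian.

Definition Grass (R : realType) (i d : nat) : Type :=
  {E : {vspace 'cV[R]_d} | \dim E == i}.

HB.instance Definition _ (R : realType) (i d : nat) :=
  Choice.on (Grass R i d).

Definition plane_of_frame {R : realType} {i d : nat}
    (M : frames : set 'M[R]_(d, i)) : Grass R i d :=
  exist _ (column_span M) (dim_column_span M).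

(* The topology of the Grassmannian is the quotient of the topology of the
   space of frames (matrices with independent columns). *)
Section GrassTopology.
Context {R : realType} {i d : nat}.

Definition grass_open (U : set (Grass R i d)) : Prop :=
  open (plane_of_frame @^-1` U).

Lemma grass_openT : grass_open setT.
Proof. by rewrite /grass_open preimage_setT; exact: openT. Qed.

Lemma grass_openI : setI_closed grass_open.
Proof. by move=> U V; exact: openI. Qed.

Lemma grass_open_bigU (I : Type) (f : I -> set (Grass R i d)) :
  (forall j, grass_open (f j)) -> grass_open (\bigcup_j f j).
Proof.
move=> fo; rewrite /grass_open preimage_bigcup.
by apply: bigcup_open => j _; exact: fo.
Qed.

HB.instance Definition _ := isOpenTopological.Build (Grass R i d)
  grass_openT grass_openI grass_open_bigU.

End GrassTopology.

Definition plane {R : realType} {i d : nat} (E : Grass R i d) :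
  {vspace 'cV[R]_d} := sval E.

Definition act {R : realType} {d : nat} (A : 'M[R]_d)
    (E : {vspace 'cV[R]_d}) : {vspace 'cV[R]_d} :=
  (linfun (mulmx A) @: E)%VS.

Section Invariance.
Context {R : realType} {d : nat}.

Definition star {k : nat} (Sigma : set 'M[R]_d) (C : set (Grass R k d)) :
    set (Grass R k d) :=
  [set F | exists A E, [/\ Sigma A, C E & plane F = act A (plane E)]].

Definition strictly_invariant {k : nat} (Sigma : set 'M[R]_d)
    (C : set (Grass R k d)) : Prop :=
  closure (star Sigma C) `<=` C°.

Definition transverse {k l : nat} (E : Grass R k d) (F : Grass R l d) : Prop :=
  (plane E :&: plane F)%VS = 0%VS.

Definition directions {k : nat} (E : Grass R k d) : set (Grass R 1 d) :=
  [set L | (plane L <= plane E)%VS].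

End Invariance.

Definition components {T : topologicalType} (C : set T) : set (set T) :=
  [set connected_component C x | x in C].

Definition finitely_many_separated_components {T : topologicalType}
    (C : set T) : Prop :=
  finite_set (components C) /\ trivIset (components C) (@closure T).

(* Main.v *)
(* Write [N P] for a norm of the [i]-th exterior power of [P]. Domination says
   that the exterior power of a product [Q] of [n] matrices of [Sigma] is a
   rank-one matrix up to a relative error [O(tau ^ n)], whence
     N (P Q T) N Q = N (P Q) N (Q T) + O(tau ^ n) N P (N Q) ^ 2 N T,
   where [T] may also be (the Pluecker vector of) a frame of an [i]-plane. This
   forces [N (P Q) >= delta N P N Q] for all products. Consider the planes that
   every product [P] expands by at least [c N P]. By the displayed estimate, a
   long product sends such a plane, even for a small [c], to one for which
   [c = 3 delta / 4]; so the images of these planes under products of length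
   [< n], with slowly decreasing thresholds, form a strictly invariant set [O].
   The kernel of the functional in the rank-one approximation of one long
   product is transverse to it. Finally [closure (Sigma O)] is a compact subset
   of the interior of [O], and a finite union of closed connected
   neighbourhoods of its points has finitely many closed components. Part (ii)
   follows by taking all the directions contained in the planes of [O]. *)
Require Import Defs.
From mathcomp Require Import all_boot all_order all_algebra fingroup perm
  finmap.
From mathcomp Require Import all_classical all_reals all_analysis.
From mathcomp Require Import ring lra zify.
Set Implicit Arguments.
Unset Strict Implicit.
Unset Printing Implicit Defensive.
Import Order.TTheory GRing.Theory Num.Theory.
Import numFieldNormedType.Exports.
Local Open Scope classical_set_scope.
Local Open Scope ring_scope.

(** * Minors and compound matrices *)

(** Passing to the exterior power turns [i]-planes into lines and the [i]-th singular gap into a gap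
    after the first singular value. Domination controls each product separately and says nothing
    about how two consecutive factors fit together: the plane that [Q] expands most could be sent
    close to planes that [P] expands badly, and [N (P Q)] would then be far below [N P * N Q].
    Excluding this uniformly, by the constant [delta], is the crux. The contradiction is with
    invertibility: letters and their inverses are bounded, so the norm of a product of given length
    cannot be too small. Only finite words occur, and no limit splitting along infinite sequences
    has to be built. The planes with one fixed threshold [c] need not form an invariant set, since
    after one letter the estimates only guarantee [c * delta]. A long product restores the loss,
    which is why the invariant set collects images under all shorter words. *)

Lemma det_mulmx_expand (R : comNzRingType) i n (A : 'M[R]_(i, n))
    (B : 'M[R]_(n, i)) :
  \det (A *m B) =
  \sum_(h : {ffun 'I_i -> 'I_n}) (\prod_k A k (h k)) * \det (rowsub h B).
Proof.
under [RHS]eq_bigr do rewrite big_distrr /=.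
rewrite exchange_big /=; apply: eq_bigr => s _.
under eq_bigr do rewrite mxE.
rewrite bigA_distr_bigA big_distrr /=; apply: eq_bigr => h _.
rewrite big_split /= mulrCA; congr (_ * (_ * _)).
by apply: eq_bigr => k _; rewrite mxE.
Qed.

(** The sum runs over all maps [h], whence the factor [i!]: each of the [i!] permutations reindexes
    the row expansion of the same determinant, and adding up the results rebuilds
    [\det (colsub h A)]. *)
Lemma cauchy_binet (R : comNzRingType) i n (A : 'M[R]_(i, n))
    (B : 'M[R]_(n, i)) :
  \sum_(h : {ffun 'I_i -> 'I_n}) \det (colsub h A) * \det (rowsub h B) =
  i`!%:R * \det (A *m B).
Proof.
have permute (s : 'S_i) : \det (A *m B) = \sum_(h : {ffun 'I_i -> 'I_n})
    ((-1) ^+ s * \prod_k A k (h (s k))) * \det (rowsub h B).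
  rewrite det_mulmx_expand.
  pose f (h : {ffun 'I_i -> 'I_n}) := [ffun k => h (s k)].
  have fI : injective f.
    move=> h h' /ffunP E; apply/ffunP => k.
    by have := E ((s^-1)%g k); rewrite !ffunE permKV.
  rewrite (reindex_inj fI); apply: eq_bigr => h _.
  have -> : rowsub (f h) B = row_perm s (rowsub h B).
    by apply/matrixP => a b; rewrite !mxE ffunE.
  rewrite row_permE det_mulmx det_perm mulrA; congr (_ * _).
  by rewrite mulrC; congr (_ * _); apply: eq_bigr => k _; rewrite ffunE.
have -> : i`!%:R * \det (A *m B) = \sum_(s : 'S_i) \det (A *m B).
  rewrite sumr_const (_ : #|_| = i`!) ?mulr_natl //.
  by rewrite -[RHS]card_Sn; apply: eq_card => s; rewrite !inE.
rewrite (eq_bigr _ (fun s _ => permute s)).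
rewrite exchange_big; apply: eq_bigr => h _ /=.
rewrite /(\det (colsub h A)) big_distrl /=; apply: eq_bigr => s _.
by congr (_ * _ * _); apply: eq_bigr => k _; rewrite mxE.
Qed.

Section Compound.
Context {R : realFieldType}.

(** This norm is submultiplicative and, on a column times a row, exactly multiplicative, which
    leaves no constant in the rank-one identity behind [l1norm_middle]. *)
Definition l1norm m n (A : 'M[R]_(m, n)) : R := \sum_a \sum_b `|A a b|.

Lemma l1norm_ge0 m n (A : 'M[R]_(m, n)) : 0 <= l1norm A.
Proof. by apply: sumr_ge0 => a _; apply: sumr_ge0. Qed.

Lemma ler_l1normD m n (A B : 'M[R]_(m, n)) :
  l1norm (A + B) <= l1norm A + l1norm B.
Proof.
rewrite /l1norm -big_split /=; apply: ler_sum => a _.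
by rewrite -big_split; apply: ler_sum => b _; rewrite mxE ler_normD.
Qed.

Lemma l1normN m n (A : 'M[R]_(m, n)) : l1norm (- A) = l1norm A.
Proof. by apply: eq_bigr => a _; apply: eq_bigr => b _; rewrite mxE normrN. Qed.

Lemma l1normB m n (A B : 'M[R]_(m, n)) : l1norm (A - B) = l1norm (B - A).
Proof. by rewrite -opprB l1normN. Qed.

Lemma l1normZ m n (c : R) (A : 'M[R]_(m, n)) :
  l1norm (c *: A) = `|c| * l1norm A.
Proof.
rewrite /l1norm mulr_sumr; apply: eq_bigr => a _; rewrite mulr_sumr.
by apply: eq_bigr => b _; rewrite mxE normrM.
Qed.

Lemma l1norm0 m n : l1norm (0 : 'M[R]_(m, n)) = 0.
Proof.
by apply: big1 => a _; apply: big1 => b _; rewrite mxE normr0.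
Qed.

Lemma entry_le_l1norm m n (A : 'M[R]_(m, n)) a b : `|A a b| <= l1norm A.
Proof.
rewrite /l1norm (bigD1 a) //= (bigD1 b) //= -addrA lerDl.
by rewrite addr_ge0 // ?sumr_ge0 // => k _; rewrite sumr_ge0.
Qed.

Lemma l1norm_eq0 m n (A : 'M[R]_(m, n)) : l1norm A = 0 -> A = 0.
Proof.
move=> A0; apply/matrixP => a b; rewrite mxE; apply/eqP.
by rewrite -normr_le0 -A0 entry_le_l1norm.
Qed.

Lemma l1norm_gt0 m n (A : 'M[R]_(m, n)) : (0 < l1norm A) = (A != 0).
Proof.
rewrite lt_def l1norm_ge0 andbT; apply/idP/idP; apply: contraNN => /eqP.
  by move=> ->; rewrite l1norm0.
by move=> /l1norm_eq0 ->.
Qed.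

Lemma l1normM m n p (A : 'M[R]_(m, n)) (B : 'M[R]_(n, p)) :
  l1norm (A *m B) <= l1norm A * l1norm B.
Proof.
rewrite /l1norm mulr_suml; apply: ler_sum => a _.
rewrite mulr_suml; apply: (@le_trans _ _ (\sum_b \sum_k `|A a k| * `|B k b|)).
  apply: ler_sum => b _; rewrite mxE; apply: le_trans (ler_norm_sum _ _ _) _.
  by apply: ler_sum => k _; rewrite normrM.
rewrite exchange_big /=; apply: ler_sum => k _.
rewrite -mulr_sumr ler_wpM2l // [leRHS](bigD1 k) //= lerDl.
by apply: sumr_ge0 => l _; apply: sumr_ge0.
Qed.

Lemma l1norm_rank1 m n (x : 'cV[R]_m) (y : 'rV[R]_n) :
  l1norm (x *m y) = l1norm x * l1norm y.
Proof.
rewrite /l1norm mulr_suml; apply: eq_bigr => a _; rewrite big_ord1.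
rewrite big_ord1 mulr_sumr; apply: eq_bigr => b _.
by rewrite mxE big_ord1 normrM.
Qed.

Lemma l1norm_le_const m n (c : R) (A : 'M[R]_(m, n)) :
  (forall a b, `|A a b| <= c) -> l1norm A <= (m * n)%:R * c.
Proof.
move=> Ac; apply: le_trans (_ : \sum_(a < m) \sum_(b < n) c <= _).
  by apply: ler_sum => a _; apply: ler_sum => b _.
by rewrite !sumr_const !card_ord -mulrnA mulr_natl mulnC.
Qed.

(* A matrix close to rank one makes the norm of a product almost
   multiplicative when it is used as a middle factor. *)
Lemma l1norm_middle m n p q (P : 'M[R]_(m, n)) (x : 'cV[R]_n) (y : 'rV[R]_p)
    (E : 'M[R]_(n, p)) (T : 'M[R]_(p, q)) (eps : R) :
  let Q := x *m y + E in
  l1norm E <= eps * l1norm Q ->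
  l1norm (P *m Q) * l1norm (Q *m T) <=
    l1norm (P *m Q *m T) * l1norm Q +
    6 * eps * (l1norm P * l1norm Q ^+ 2 * l1norm T).
Proof.
move=> Q hE.
have [Q0|Qneq0] := eqVneq (l1norm Q) 0.
  have -> : Q = 0 by exact: l1norm_eq0.
  by rewrite !mulmx0 !mul0mx !l1norm0 expr0n !(mul0r, mulr0, addr0).
have Qgt0 : 0 < l1norm Q by rewrite lt_def Qneq0 l1norm_ge0.
have eps0 : 0 <= eps by rewrite -(pmulr_lge0 _ Qgt0) (le_trans (l1norm_ge0 _)
  hE).
have EP : l1norm (P *m E) <= l1norm P * (eps * l1norm Q).
  by apply: le_trans (l1normM _ _) _; rewrite ler_wpM2l ?l1norm_ge0.
have ET : l1norm (E *m T) <= eps * l1norm Q * l1norm T.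
  by apply: le_trans (l1normM _ _) _; rewrite ler_wpM2r ?l1norm_ge0.
have EPT : l1norm (P *m E *m T) <= l1norm P * (eps * l1norm Q) * l1norm T.
  by apply: le_trans (l1normM _ _) _; rewrite ler_wpM2r ?l1norm_ge0.
have PQ : l1norm (P *m Q) <= l1norm P * l1norm Q by exact: l1normM.
have QT : l1norm (Q *m T) <= l1norm Q * l1norm T by exact: l1normM.
have PQT : l1norm (P *m Q *m T) <= l1norm P * l1norm Q * l1norm T.
  by apply: le_trans (l1normM _ _) _; rewrite ler_wpM2r ?l1norm_ge0.
set p0 := l1norm P in EP EPT PQ PQT *; set t0 := l1norm T in ET EPT QT PQT *.
have p00 : 0 <= p0 by exact: l1norm_ge0.
have t00 : 0 <= t0 by exact: l1norm_ge0.
(* For [eps >= 1] submultiplicativity already suffices; [eps < 1] lets the quadratic errors below be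
   absorbed into linear ones. *)
have [eps1|eps1] := leP 1 eps.
  have a0 : 0 <= p0 * l1norm Q ^+ 2 * t0.
    by rewrite !mulr_ge0 ?exprn_ge0 // ltW.
  have le1 : p0 * l1norm Q ^+ 2 * t0 <= 6 * eps * (p0 * l1norm Q ^+ 2 * t0).
    by rewrite ler_peMl //; lra.
  apply: le_trans (_ : p0 * l1norm Q * (l1norm Q * t0) <= _).
    by rewrite ler_pM ?l1norm_ge0.
  rewrite (_ : p0 * l1norm Q * _ = p0 * l1norm Q ^+ 2 * t0); last by ring.
  by apply: le_trans le1 _; rewrite lerDr mulr_ge0 ?l1norm_ge0.
pose X := x *m y.
have tri k l (A B : 'M[R]_(k, l)) : `|l1norm (A + B) - l1norm A| <= l1norm B.
  rewrite ler_distl; apply/andP; split; last by rewrite ler_l1normD.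
  have := ler_l1normD (A + B) (- B); rewrite addrK l1normN; lra.
have dX : `|l1norm Q - l1norm X| <= eps * l1norm Q.
  by apply: le_trans (tri _ _ _ _) hE.
have dPX : `|l1norm (P *m Q) - l1norm (P *m X)| <= p0 * (eps * l1norm Q).
  by rewrite /Q mulmxDr; apply: le_trans (tri _ _ _ _) EP.
have dXT : `|l1norm (Q *m T) - l1norm (X *m T)| <= eps * l1norm Q * t0.
  by rewrite /Q mulmxDl; apply: le_trans (tri _ _ _ _) ET.
have dPXT : `|l1norm (P *m Q *m T) - l1norm (P *m X *m T)| <=
    p0 * (eps * l1norm Q) * t0.
  by rewrite /Q mulmxDr mulmxDl; apply: le_trans (tri _ _ _ _) EPT.
(* For the exact rank-one matrix both sides are the product of the norms of [P *m x], [y], [x] and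
   [y *m T]. *)
have key : l1norm (P *m X) * l1norm (X *m T) =
    l1norm (P *m X *m T) * l1norm X.
  rewrite /X !mulmxA -(mulmxA x) -(mulmxA (P *m x)) !l1norm_rank1.
  by ring.
move: key dX dPX dXT dPXT PQ QT PQT Qgt0; clear - p00 t00 eps0 eps1.
set a := l1norm (P *m Q); set a' := l1norm (P *m X).
set b := l1norm (Q *m T); set b' := l1norm (X *m T).
set c := l1norm (P *m Q *m T); set c' := l1norm (P *m X *m T).
set s := l1norm Q; set s' := l1norm X.
move=> key ds da db dc PQ QT PQT s0.
have a0 : 0 <= a by exact: l1norm_ge0.
have b0 : 0 <= b by exact: l1norm_ge0.
have c0 : 0 <= c by exact: l1norm_ge0.
have w0 : 0 <= p0 * s ^+ 2 * t0 by rewrite !mulr_ge0 ?exprn_ge0 // ltW.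
have bound : `|a * b - c * s| <= 6 * eps * (p0 * s ^+ 2 * t0).
  (* The rank-one values cancel by [key]; each of the six remaining terms is at most [eps] times the
     same product, which is the origin of the constant 6. *)
  have -> : a * b - c * s = (a - a') * b + (b - b') * a - (b - b') * (a - a')
      - ((c - c') * s + c * (s - s') - (c - c') * (s - s')).
    by transitivity (a * b - c * s + (c' * s' - a' * b'));
      [rewrite key subrr addr0 | ring].
  have t1 : `|(a - a') * b| <= eps * (p0 * s ^+ 2 * t0).
    rewrite normrM (ger0_norm b0).
    rewrite (_ : eps * _ = (p0 * (eps * s)) * (s * t0)); last by ring.
    by rewrite ler_pM.
  have t2 : `|(b - b') * a| <= eps * (p0 * s ^+ 2 * t0).
    rewrite normrM (ger0_norm a0).
    rewrite (_ : eps * _ = (eps * s * t0) * (p0 * s)); last by ring.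
    by rewrite ler_pM.
  have sq : eps * eps * (p0 * s ^+ 2 * t0) <= eps * (p0 * s ^+ 2 * t0).
    by rewrite ler_wpM2r // ler_piMl // ltW.
  have t3 : `|(b - b') * (a - a')| <= eps * (p0 * s ^+ 2 * t0).
    apply: le_trans sq; rewrite normrM.
    rewrite (_ : eps * _ * _ = (eps * s * t0) * (p0 * (eps * s))); last by ring.
    by rewrite ler_pM.
  have t4 : `|(c - c') * s| <= eps * (p0 * s ^+ 2 * t0).
    rewrite normrM (gtr0_norm s0).
    rewrite (_ : eps * _ = (p0 * (eps * s) * t0) * s); last by ring.
    by rewrite ler_wpM2r // ltW.
  have t5 : `|c * (s - s')| <= eps * (p0 * s ^+ 2 * t0).
    rewrite normrM (ger0_norm c0).
    rewrite (_ : eps * _ = (p0 * s * t0) * (eps * s)); last by ring.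
    by rewrite ler_pM.
  have t6 : `|(c - c') * (s - s')| <= eps * (p0 * s ^+ 2 * t0).
    apply: le_trans sq; rewrite normrM.
    rewrite (_ : eps * _ * _ = (p0 * (eps * s) * t0) * (eps * s)); last by ring.
    by rewrite ler_pM.
  move: t1 t2 t3 t4 t5 t6; rewrite !ler_norml => /andP[??] /andP[??] /andP[??].
  by move=> /andP[??] /andP[??] /andP[??]; apply/andP; split; lra.
by move: bound; rewrite ler_norml => /andP[? ?]; lra.
Qed.

Variable i : nat.
Local Notation idx n := {ffun 'I_i -> 'I_n}.

Definition multi n (a : 'I_#|{: idx n}|) : idx n := enum_val a.

(* The [i]-th exterior power, with rows and columns indexed by all functions
   ['I_i -> 'I_n] instead of the increasing ones; the factor [1 / i!] makes it
   multiplicative, and the image of the identity is a projector. *)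
Definition compound m n (A : 'M[R]_(m, n)) : 'M[R]_(#|{: idx m}|, #|{: idx n}|)
  :=
  \matrix_(a, b) (i`!%:R^-1 * \det (mxsub (multi a) (multi b) A)).

Definition plucker m (M : 'M[R]_(m, i)) : 'cV[R]_#|{: idx m}| :=
  \col_a \det (rowsub (multi a) M).

Definition coplucker n (N : 'M[R]_(i, n)) : 'rV[R]_#|{: idx n}| :=
  \row_b \det (colsub (multi b) N).

Lemma factr_neq0 : i`!%:R != 0 :> R.
Proof. by rewrite pnatr_eq0 -lt0n fact_gt0. Qed.

Lemma sum_multi n (F : idx n -> R) : \sum_a F (multi a) = \sum_h F h.
Proof. by rewrite /multi -(big_enum_val F). Qed.

Lemma compoundM m n p (A : 'M[R]_(m, n)) (B : 'M[R]_(n, p)) :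
  compound (A *m B) = compound A *m compound B.
Proof.
apply/matrixP => a b; rewrite !mxE.
under eq_bigr => h _ do rewrite !mxE.
rewrite (sum_multi (fun h : idx n =>
  i`!%:R^-1 * \det (mxsub (multi a) h A) *
  (i`!%:R^-1 * \det (mxsub h (multi b) B)))).
have -> : mxsub (multi a) (multi b) (A *m B) =
    rowsub (multi a) A *m colsub (multi b) B.
  by apply/matrixP => x y; rewrite !mxE; apply: eq_bigr => k _; rewrite !mxE.
apply: (mulfI factr_neq0); rewrite mulrA mulfV ?factr_neq0 // mul1r.
apply: (mulfI factr_neq0); rewrite -cauchy_binet !mulr_sumr;
  apply: eq_bigr => h _.
have -> : colsub h (rowsub (multi a) A) = mxsub (multi a) h A.
  by apply/matrixP => x y; rewrite !mxE.
have -> : rowsub h (colsub (multi b) B) = mxsub h (multi b) B.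
  by apply/matrixP => x y; rewrite !mxE.
by field; exact: factr_neq0.
Qed.

Lemma plucker_mul m n (A : 'M[R]_(m, n)) (M : 'M[R]_(n, i)) :
  plucker (A *m M) = compound A *m plucker M.
Proof.
apply/matrixP => a b; rewrite !mxE.
under eq_bigr => h _ do rewrite !mxE.
rewrite (sum_multi (fun h : idx n =>
  i`!%:R^-1 * \det (mxsub (multi a) h A) * \det (rowsub h M))).
have -> : rowsub (multi a) (A *m M) = rowsub (multi a) A *m M.
  by apply/matrixP => x y; rewrite !mxE; apply: eq_bigr => k _; rewrite !mxE.
apply: (mulfI factr_neq0); rewrite -cauchy_binet !mulr_sumr;
  apply: eq_bigr => h _.
have -> : colsub h (rowsub (multi a) A) = mxsub (multi a) h A.
  by apply/matrixP => x y; rewrite !mxE.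
by field; exact: factr_neq0.
Qed.

Lemma plucker_mulr m (M : 'M[R]_(m, i)) (g : 'M[R]_i) :
  plucker (M *m g) = \det g *: plucker M.
Proof.
apply/matrixP => a b; rewrite !mxE.
have -> : rowsub (multi a) (M *m g) = rowsub (multi a) M *m g.
  by apply/matrixP => x y; rewrite !mxE; apply: eq_bigr => k _; rewrite !mxE.
by rewrite det_mulmx mulrC.
Qed.

(** A matrix factoring through dimension [i] has an exterior power of rank one; this supplies the
    rank-one approximants. *)
Lemma compound_mul_thin m n (M : 'M[R]_(m, i)) (N : 'M[R]_(i, n)) :
  compound (M *m N) = i`!%:R^-1 *: (plucker M *m coplucker N).
Proof.
apply/matrixP => a b; rewrite !mxE big_ord1 !mxE -det_mulmx; congr (_ * \det _).
by apply/matrixP => x y; rewrite !mxE; apply: eq_bigr => k _; rewrite !mxE.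
Qed.

(** The functional [coplucker N] vanishes on the plane of [M] exactly when [N *m M] is singular. For
    [N = M^T] the pairing is the Gram determinant, up to [i!]. *)
Lemma coplucker_plucker n (N : 'M[R]_(i, n)) (M : 'M[R]_(n, i)) :
  coplucker N *m plucker M = (i`!%:R * \det (N *m M))%:M.
Proof.
apply/matrixP => a b; rewrite !ord1 !mxE eqxx mulr1n -cauchy_binet.
under eq_bigr => h _ do rewrite !mxE.
by rewrite (sum_multi (fun h : idx n => \det (colsub h N) * \det (rowsub h M))).
Qed.

End Compound.

(** * The spectral theorem and singular values *)

Section MatrixContinuity.
Context {R : realType} {T : Type}.

Lemma cvg_mx m n (F : set_system T) {FF : Filter F} (f : T -> 'M[R]_(m, n))
    (M : 'M[R]_(m, n)) :
  (forall i j, (fun x => f x i j) @ F --> M i j) -> f @ F --> M.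
Proof.
move=> cf A [P MP sPA].
suff : F (fun x => forall i j, P i j (f x i j)).
  by move=> FP; apply: (@filterS _ F _ _ (f @^-1` A) _ FP) => x Px; exact: sPA.
apply: filter_forall => i; apply: filter_forall => j.
exact: (cf i j _ (MP i j)).
Qed.

Lemma cvg_coord m n (F : set_system T) {FF : Filter F} (f : T -> 'M[R]_(m, n))
    (M : 'M[R]_(m, n)) i j :
  f @ F --> M -> (fun x => f x i j) @ F --> M i j.
Proof.
move=> fM; apply: (@cvg_comp _ _ _ f (fun N : 'M[R]_(m, n) => N i j) _ _ _ fM).
exact: coord_continuous.
Qed.

Lemma cvg_sum (I : Type) (r : seq I) (P : pred I) (F : set_system T)
    {FF : Filter F} (f : I -> T -> R) (l : I -> R) :
  (forall i, f i @ F --> l i) ->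
  (fun x => \sum_(i <- r | P i) f i x) @ F --> \sum_(i <- r | P i) l i.
Proof.
move=> fl; elim: r => [|i r IH].
  rewrite big_nil; under eq_fun do rewrite big_nil; exact: cvg_cst.
rewrite big_cons; under eq_fun do rewrite big_cons.
by case: (P i) => //; apply: cvgD.
Qed.

Lemma cvg_prodr (I : Type) (r : seq I) (P : pred I) (F : set_system T)
    {FF : Filter F} (f : I -> T -> R) (l : I -> R) :
  (forall i, f i @ F --> l i) ->
  (fun x => \prod_(i <- r | P i) f i x) @ F --> \prod_(i <- r | P i) l i.
Proof.
move=> fl; elim: r => [|i r IH].
  rewrite big_nil; under eq_fun do rewrite big_nil; exact: cvg_cst.
rewrite big_cons; under eq_fun do rewrite big_cons.
by case: (P i) => //; apply: cvgM.
Qed.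

Lemma cvg_mulmx m n p (F : set_system T) {FF : Filter F}
    (f : T -> 'M[R]_(m, n)) (g : T -> 'M[R]_(n, p)) (M : 'M[R]_(m, n))
    (N : 'M[R]_(n, p)) :
  f @ F --> M -> g @ F --> N -> (fun x => f x *m g x) @ F --> M *m N.
Proof.
move=> fM gN; apply: cvg_mx => i j; rewrite mxE; under eq_fun do rewrite mxE.
by apply: cvg_sum => k; apply: cvgM; exact: cvg_coord.
Qed.

Lemma cvg_trmx m n (F : set_system T) {FF : Filter F}
    (f : T -> 'M[R]_(m, n)) (M : 'M[R]_(m, n)) :
  f @ F --> M -> (fun x => (f x)^T) @ F --> M^T.
Proof.
move=> fM; apply: cvg_mx => i j; rewrite mxE; under eq_fun do rewrite mxE.
exact: cvg_coord.
Qed.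

Lemma cvg_det n (F : set_system T) {FF : Filter F}
    (f : T -> 'M[R]_n) (M : 'M[R]_n) :
  f @ F --> M -> (fun x => \det (f x)) @ F --> \det M.
Proof.
move=> fM; apply: cvg_sum => s; apply: cvgM; first exact: cvg_cst.
by apply: cvg_prodr => i; exact: cvg_coord.
Qed.

End MatrixContinuity.

Section MatrixContinuous.
Context {R : realType} {T : topologicalType}.

Lemma continuous_mx m n (f : T -> 'M[R]_(m, n)) :
  (forall i j, continuous (fun x => f x i j)) -> continuous f.
Proof. by move=> cf x; apply: cvg_mx => i j; exact: cf. Qed.

Lemma continuous_coord m n (f : T -> 'M[R]_(m, n)) i j :
  continuous f -> continuous (fun x => f x i j).
Proof. move=> cf x; have h := (@cvg_coord R T _ _ (nbhs x) (nbhs_filter x) f (f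
  x) i j (cf x)).
exact: h.
Qed.

Lemma continuous_mulmx m n p (f : T -> 'M[R]_(m, n)) (g : T -> 'M[R]_(n, p)) :
  continuous f -> continuous g -> continuous (fun x => f x *m g x).
Proof.
move=> cf cg x.
have h := @cvg_mulmx R T _ _ _ (nbhs x) (nbhs_filter x) f g _ _ (cf x) (cg x).
exact: h.
Qed.

Lemma continuous_trmx m n (f : T -> 'M[R]_(m, n)) :
  continuous f -> continuous (fun x => (f x)^T).
Proof. move=> cf x; have h := @cvg_trmx R T _ _ (nbhs x) (nbhs_filter x) f _
  (cf x).
exact: h. Qed.

Lemma continuous_det n (f : T -> 'M[R]_n) :
  continuous f -> continuous (fun x => \det (f x)).
Proof. move=> cf x; have h := @cvg_det R T _ (nbhs x) (nbhs_filter x) f _ (cf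
  x).
exact: h. Qed.

End MatrixContinuous.

Section Spectral.
Context {R : realType}.

(* A maximum [v] of the Rayleigh quotient on the unit sphere is an eigenvector:
   the form [S - l] is nonpositive and vanishes at [v]. *)
Lemma sym_eigenvector n (S : 'M[R]_n.+1) : S^T = S ->
  exists (v : 'rV[R]_n.+1) (l : R), v *m v^T = 1%:M /\ v *m S = l *: v.
Proof.
move=> symS.
pose sph := [set v : 'rV[R]_n.+1 | v *m v^T = 1%:M].
pose f (v : 'rV[R]_n.+1) := (v *m S *m v^T) 0 0.
have sq_ge0 (v : 'rV[R]_n.+1) : 0 <= (v *m v^T) 0 0.
  by rewrite mxE sumr_ge0 // => j _; rewrite mxE -expr2 sqr_ge0.
have coord_le (v : 'rV[R]_n.+1) j : (v 0 j) ^+ 2 <= (v *m v^T) 0 0.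
  rewrite mxE (bigD1 j) //= mxE -expr2 lerDl sumr_ge0 // => k _.
  by rewrite mxE -expr2 sqr_ge0.
have sq_eq0 (v : 'rV[R]_n.+1) : (v *m v^T) 0 0 = 0 -> v = 0.
  move=> v0; apply/rowP => j; rewrite mxE; apply/eqP.
  by rewrite -sqrf_eq0 eq_le sqr_ge0 andbT -v0 coord_le.
have csq : continuous (fun v : 'rV[R]_n.+1 => (v *m v^T) 0 0).
  apply: continuous_coord; apply: continuous_mulmx; first by move=> ?;
    exact: cvg_id.
  by apply: continuous_trmx; move=> ?; exact: cvg_id.
have sph0 : sph !=set0.
  exists (delta_mx 0 0); rewrite /sph /= trmx_delta mul_delta_mx.
  by apply/matrixP => a b; rewrite !ord1 !mxE.
have sphE v : sph v <-> (v *m v^T) 0 0 = 1.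
  split=> [->|v1]; first by rewrite mxE.
  by apply/matrixP => a b; rewrite !ord1 v1 !mxE.
have csph : compact sph.
  apply: bounded_closed_compact.
    exists 1; split; first exact: num_real.
    move=> x x1 v /sphE v1 /=; rewrite [leLHS]/Num.Def.normr /= mx_normrE.
    apply/bigmax_leP; split; first by lra.
    move=> [a j] _ /=; rewrite ord1; apply: le_trans (ltW x1).
    by rewrite -(ler_pXn2r (ltn0Sn 1)) ?nnegrE // real_normK ?num_real //
      expr1n -v1.
  have -> : sph = (fun v => (v *m v^T) 0 0) @^-1` [set 1 : R].
    by apply/seteqP; split=> v /sphE.
  by apply: preimage_closed => //; exact: closed_eq.
have cf : continuous f.
  apply: continuous_coord; apply: continuous_mulmx.
    by apply: continuous_mulmx; [by move=> ?;
      exact: cvg_id | exact: cst_continuous].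
  by apply: continuous_trmx; move=> ?; exact: cvg_id.
have [v] := @EVT_max_rV R n.+1 f sph sph0 csph (continuous_subspaceT cf).
rewrite inE => v1 vmax.
exists v, (f v); split=> //.
set l := f v in vmax *.
pose T := S - l%:M.
have symT : T^T = T by rewrite /T linearB /= symS tr_scalar_mx.
pose g (x : 'rV[R]_n.+1) := (x *m T *m x^T) 0 0.
have gE x : g x = f x - l * (x *m x^T) 0 0.
  rewrite /g /T mulmxBr mulmxBl [LHS]mxE; congr (_ + _).
  by rewrite mul_mx_scalar -scalemxAl !mxE.
have g_le0 x : g x <= 0.
  have [x0|x0] := eqVneq ((x *m x^T) 0 0) 0.
    by rewrite gE x0 (sq_eq0 _ x0) /f !mul0mx mxE mulr0 subrr.
  set q := (x *m x^T) 0 0 in x0.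
  have q0 : 0 < q by rewrite lt_def x0 sq_ge0.
  pose s := (Num.sqrt q)^-1.
  have s2 : s ^+ 2 = q^-1 by rewrite /s exprVn sqr_sqrtr ?ltW.
  have : f (s *: x) <= l.
    apply: vmax; rewrite inE; apply/sphE.
    rewrite linearZ /= -scalemxAl -scalemxAr scalerA mxE -expr2 s2.
    by rewrite mulVf ?gt_eqF.
  rewrite {1}/f linearZ /= -!scalemxAl -!scalemxAr scalerA mxE -expr2 s2.
  by rewrite mulrC ler_pdivrMr // gE subr_le0.
have TE : T = S - l%:M by [].
clearbody T.
(* Half the gradient of [g] at its maximum [v]. Moving along [y] raises [g] to first order by twice
   the squared length of [y], so [y] must vanish. *)
pose y := v *m T.
have gv : g v = 0 by rewrite gE (sphE v).1 // mulr1 subrr.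
have expand t : g (v + t *: y) = t * (2 * (y *m y^T) 0 0) + t ^+ 2 * g y.
  have trD : (v + t *: y)^T = v^T + t *: y^T by rewrite linearD /= linearZ.
  rewrite -[RHS]add0r -gv /g trD !(mulmxDl, mulmxDr).
  have -> : t *: y *m T *m v^T = t *: (y *m y^T).
    by rewrite -!scalemxAl /y trmx_mul symT !mulmxA.
  have -> : v *m T *m (t *: y^T) = t *: (y *m y^T) by rewrite -scalemxAr.
  have -> : t *: y *m T *m (t *: y^T) = (t ^+ 2) *: (y *m T *m y^T).
    by rewrite -!scalemxAl -scalemxAr scalerA expr2.
  rewrite !mxE; ring.
have b0 : (y *m y^T) 0 0 = 0.
  set b := (y *m y^T) 0 0 in expand *.
  have bge0 : 0 <= b by exact: sq_ge0.
  (* This size keeps the quadratic term below the linear one: [2 + t * g y] stays positive. *)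
  pose t := (1 + `|g y|)^-1.
  have den : 0 < 1 + `|g y| by rewrite ltr_pwDl.
  have t0 : 0 < t by rewrite invr_gt0.
  have := g_le0 (v + t * b *: y); rewrite expand => h.
  have h2 : t * b ^+ 2 * (2 + t * g y) <= 0.
    by apply: le_trans h; rewrite le_eqVlt; apply/orP; left; apply/eqP; ring.
  have tg : `|t * g y| <= 1.
    rewrite normrM gtr0_norm // mulrC ler_pdivrMr // mul1r; lra.
  have pos : 0 < 2 + t * g y.
    by move: tg; rewrite ler_norml => /andP[? _]; lra.
  move: h2; rewrite pmulr_lle0 // pmulr_rle0 // => h2.
  by apply/eqP; rewrite -sqrf_eq0 eq_le h2 sqr_ge0.
have := sq_eq0 _ b0; rewrite /y TE mulmxBr mul_mx_scalar => /eqP.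
by rewrite subr_eq0 => /eqP.
Qed.

(* The Householder reflection exchanging [v] and the first basis vector. *)
Lemma orthogonal_completion n (v : 'rV[R]_n.+1) : v *m v^T = 1%:M ->
  exists H : 'M[R]_n.+1, [/\ H *m H^T = 1%:M & row 0 H = v].
Proof.
move=> v1; pose e : 'rV[R]_n.+1 := delta_mx 0 0.
have [->|ve] := eqVneq v e.
  by exists 1%:M; rewrite trmx1 mulmx1 row1.
pose w := v - e; pose q := (w *m w^T) 0 0.
have q0 : q != 0.
  apply: contra ve => /eqP q0; rewrite -subr_eq0 -/w; apply/eqP/rowP => j.
  rewrite [RHS]mxE; apply/eqP; rewrite -sqrf_eq0 eq_le sqr_ge0 andbT -q0 /q.
  rewrite [leRHS]mxE (bigD1 j) //= [w^T _ _]mxE -expr2 lerDl sumr_ge0 // => k _.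
  by rewrite [w^T _ _]mxE -expr2 sqr_ge0.
have wwT : w *m w^T = q%:M by exact: mx11_scalar.
pose P := q^-1 *: (w^T *m w).
have PP : P *m P = P.
  rewrite /P -scalemxAl -scalemxAr mulmxA -(mulmxA w^T) wwT.
  by rewrite mul_mx_scalar -scalemxAl !scalerA; congr (_ *: _); field.
have PT : P^T = P by rewrite /P linearZ /= trmx_mul trmxK.
pose H := 1%:M - 2 *: P.
have HT : H^T = H by rewrite /H linearB /= trmx1 linearZ /= PT.
exists H; split.
  rewrite HT /H mulmxBl mul1mx mulmxBr mulmx1 -scalemxAl -scalemxAr PP.
  by clearbody P; apply/matrixP => a b; rewrite !mxE; ring.
have eeT : e *m e^T = 1%:M.
  by rewrite trmx_delta mul_delta_mx; apply/matrixP => a b; rewrite !ord1 !mxE.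
have veT : v *m e^T = (e *m v^T)^T by rewrite trmx_mul trmxK.
pose c := (e *m v^T) 0 0.
have evT : e *m v^T = c%:M by exact: mx11_scalar.
have ewT : e *m w^T = (c - 1)%:M.
  by rewrite /w linearB /= mulmxBr evT eeT -raddfB.
have qE : q = 2 * (1 - c).
  rewrite /q /w linearB /= mulmxBr !mulmxBl v1 eeT veT evT tr_scalar_mx.
  by rewrite !mxE eqxx !mulr1n; ring.
have -> : row 0 H = e *m H by rewrite -rowE.
rewrite /H mulmxBr mulmx1 -scalemxAr /P -scalemxAr mulmxA ewT mul_scalar_mx.
rewrite !scalerA (_ : 2 / q * (c - 1) = -1).
  by rewrite scaleN1r opprK /w addrC subrK.
have c1 : 1 - c != 0 by apply: contraNneq q0; rewrite qE => ->; rewrite mulr0.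
by rewrite qE; field.
Qed.

Lemma sym_spectral n (S : 'M[R]_n) : S^T = S ->
  exists (V : 'M[R]_n) (D : 'rV[R]_n),
    V *m V^T = 1%:M /\ S = V^T *m diag_mx D *m V.
Proof.
elim: n S => [|n IH] S symS.
  by exists 1%:M, 0; split; apply/matrixP => -[].
have [v [l [v1 vS]]] := sym_eigenvector symS.
have [H [HH H0]] := orthogonal_completion v1.
have HtH : H^T *m H = 1%:M by exact: mulmx1C.
pose B : 'M[R]_(1 + n) := H *m S *m H^T.
have symB : B^T = B by rewrite /B !trmx_mul trmxK symS mulmxA.
have B0 : row 0 B = l *: delta_mx 0 0.
  rewrite /B !row_mul H0 vS -scalemxAl -H0 -row_mul HH row1.
  by congr (_ *: delta_mx _ _); apply/val_inj.
have B0e j : B (lshift n 0) j = l * (j == lshift n 0)%:R.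
  have := congr1 (fun r : 'rV_(1 + n) => r 0 j) B0; rewrite !mxE /=.
  by rewrite (_ : lshift n 0 = 0) //; exact/val_inj.
have Bul : ulsubmx B = l%:M.
  apply/matrixP => a b; rewrite !ord1 [RHS]mxE [LHS]mxE [LHS]mxE B0e eqxx mulr1.
  by rewrite eqxx mulr1n.
have Bur : ursubmx B = 0.
  apply/matrixP => a b; rewrite !ord1 [RHS]mxE [LHS]mxE [LHS]mxE B0e.
  by rewrite eq_rlshift mulr0.
have Bdl : dlsubmx B = 0.
  by rewrite -symB -trmx_ursub Bur trmx0.
have symB' : (drsubmx B)^T = drsubmx B by rewrite trmx_drsub symB.
have [V [D [VV DE]]] := IH _ symB'.
pose W : 'M[R]_(1 + n) := block_mx 1%:M 0 0 V.
have WT : W^T = block_mx 1%:M 0 0 V^T.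
  by rewrite /W tr_block_mx !trmx0 trmx1.
have WW : W *m W^T = 1%:M.
  rewrite WT /W mulmx_block !mulmx0 !mul0mx mulmx1 VV !addr0 add0r.
  by rewrite -scalar_mx_block.
pose E : 'rV[R]_(1 + n) := row_mx l%:M D.
have EE : W^T *m diag_mx E *m W = block_mx l%:M 0 0 (V^T *m diag_mx D *m V).
  have -> : diag_mx E = block_mx l%:M 0 0 (diag_mx D).
    rewrite /E diag_mx_row; congr block_mx.
    by apply/matrixP => a b; rewrite !ord1 !mxE eqxx.
  rewrite WT /W !mulmx_block !mulmx0 !mul0mx !mulmx1 !mul1mx.
  by rewrite !(addr0, add0r, mul0mx).
exists (W *m H), E; split.
  by rewrite trmx_mul mulmxA -(mulmxA W) HH mulmx1.
have -> : S = H^T *m B *m H.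
  by rewrite /B !mulmxA HtH mul1mx -mulmxA HtH mulmx1.
rewrite -(submxK B) Bul Bur Bdl DE -EE trmx_mul.
by rewrite !mulmxA.
Qed.

End Spectral.

(** * Ordered eigenvalues, the positive square root and the singular value decomposition *)

Section SingularValueDecomposition.
Context {R : realType}.

(** [eigenvalues] chooses some sorted factorisation of the characteristic polynomial; uniqueness of
    the roots with multiplicity and of their sorted order forces the chosen list to be the
    diagonal. *)
Lemma eigenvalues_diag n (V : 'M[R]_n) (D : 'rV[R]_n) :
  V *m V^T = 1%:M -> (forall a b : 'I_n, (a <= b)%N -> D 0 b <= D 0 a) ->
  eigenvalues (V^T *m diag_mx D *m V) = [seq D 0 k | k <- enum 'I_n].
Proof.
move=> VV Ds; set S := V^T *m diag_mx D *m V.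
have VtV : V^T *m V = 1%:M by exact: mulmx1C.
have charS : char_poly S = \prod_(x <- [seq D 0 k | k <- enum 'I_n]) ('X -
  x%:P).
  rewrite big_map big_enum /= -(eq_bigr _ (fun k _ =>
    congr1 (fun x => 'X - x%:P) (_ : diag_mx D k k = D 0 k))); last first.
    by move=> k _; rewrite mxE eqxx mulr1n.
  rewrite -char_poly_trig ?diag_mx_is_trig //.
  pose W := map_mx polyC V.
  have WT : map_mx polyC V^T = W^T by apply/matrixP => a b; rewrite !mxE.
  have WW : W^T *m W = 1%:M by rewrite -WT -map_mxM VtV map_mx1.
  have WW' : W *m W^T = 1%:M by exact: mulmx1C.
  rewrite /char_poly /char_poly_mx /S !map_mxM WT -/W.
  have XE : 'X%:M = W^T *m 'X%:M *m W.
    by rewrite mul_mx_scalar -scalemxAl WW scalemx1.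
  rewrite {1}XE -mulmxBl -mulmxBr !det_mulmx mulrC mulrA -det_mulmx WW' det1.
  by rewrite mul1r.
have [srt chr] : is_eigenvalues S (eigenvalues S).
  apply: (@xgetPex _ [::] [set s | is_eigenvalues S s]).
  exists [seq D 0 k | k <- enum 'I_n]; split=> //.
  rewrite sorted_map; apply: (@sub_sorted _ (fun a b : 'I_n => (a < b)%N)).
    by move=> a b ab /=; apply: Ds; exact: ltnW.
  by have := iota_ltn_sorted 0 n; rewrite -val_enum_ord sorted_map.
apply: (sorted_eq _ _ srt) => //.
- by move=> a b c /= ab bc; exact: le_trans bc ab.
- by move=> a b; rewrite andbC => /le_anti.
- rewrite sorted_map; apply: (@sub_sorted _ (fun a b : 'I_n => (a < b)%N)).
    by move=> a b ab /=; apply: Ds; exact: ltnW.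
  by have := iota_ltn_sorted 0 n; rewrite -val_enum_ord sorted_map.
- by apply: prod_XsubC_eq; rewrite -chr charS.
Qed.

Lemma sym_spectral_sorted n (S : 'M[R]_n) : S^T = S ->
  exists (V : 'M[R]_n) (D : 'rV[R]_n), [/\ V *m V^T = 1%:M,
    S = V^T *m diag_mx D *m V
    & forall a b : 'I_n, (a <= b)%N -> D 0 b <= D 0 a].
Proof.
move=> /sym_spectral[V [D [VV SE]]].
pose t := [tuple D 0 k | k < n].
have szt : size (sort >=%R t) == n by rewrite size_sort size_tuple.
have /tuple_permP[p pE] : perm_eq (Tuple szt) t by rewrite perm_sort.
have pD k : tnth (Tuple szt) k = D 0 (p k).
  have : Tuple szt = [tuple tnth t (p i) | i < n] by exact/val_inj.
  by move=> ->; rewrite !tnth_mktuple.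
exists (row_perm p V), (\row_k D 0 (p k)); split.
- apply/matrixP => a b; rewrite mxE.
  have := congr1 (fun M : 'M[R]_n => M (p a) (p b)) VV;
    rewrite !mxE (inj_eq perm_inj).
  by move=> <-; apply: eq_bigr => k _; rewrite !mxE.
- rewrite SE; apply/matrixP => a b; rewrite !mxE (reindex_inj (@perm_inj _ p)).
  apply: eq_bigr => k _; rewrite !mxE; congr (_ * _).
  rewrite (bigD1 (p k)) //= big1 ?addr0; last first.
    by move=> j jk; rewrite !mxE (negPf jk) mulr0n mulr0.
  rewrite [RHS](bigD1 k) //= big1 ?addr0; last first.
    by move=> j jk; rewrite !mxE (negPf jk) mulr0n mulr0.
  by rewrite !mxE !eqxx !mulr1n.
- move=> a b ab; rewrite !mxE -!pD !(tnth_nth 0) /=.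
  have tr : transitive (>=%R : rel R) by move=> x y z /= xy yz;
    exact: le_trans yz xy.
  have srt : sorted >=%R (sort >=%R t).
    by apply: sort_sorted => x y /=; rewrite /Order.ge /= orbC le_total.
  apply: (sorted_leq_nth tr _ 0 srt) ab; first by move=> x /=.
    by rewrite inE size_sort size_tuple.
  by rewrite inE size_sort size_tuple.
Qed.

Lemma diag_entry n (V S : 'M[R]_n) (D : 'rV[R]_n) (k : 'I_n) :
  V *m V^T = 1%:M -> S = V^T *m diag_mx D *m V ->
  D 0 k = ((row k V) *m S *m (row k V)^T) 0 0.
Proof.
move=> VV ->; rewrite rowE trmx_mul.
pose e : 'rV[R]_n := delta_mx 0 k; rewrite -/e.
have -> : e *m V *m (V^T *m diag_mx D *m V) *m (V^T *m e^T) =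
    e *m diag_mx D *m e^T.
  by rewrite !mulmxA -(mulmxA _ V V^T) VV mulmx1 -(mulmxA _ V V^T) VV mulmx1.
by rewrite /e -rowE trmx_delta -colE !mxE eqxx mulr1n.
Qed.

(** [P] may be rectangular: square matrices lead to singular values, and frames to
    orthonormalisation by the inverse root of their Gram matrix. *)
Lemma psd_sqrtP m n (P : 'M[R]_(m, n)) :
  psd (psd_sqrt (P^T *m P)) /\
  psd_sqrt (P^T *m P) *m psd_sqrt (P^T *m P) = P^T *m P.
Proof.
apply: (@xgetPex _ 0 [set S | psd S /\ S *m S = P^T *m P]).
have symM : (P^T *m P)^T = P^T *m P by rewrite trmx_mul trmxK.
have [V [D [VV SE]]] := sym_spectral symM.
have sq_ge0 (v : 'cV[R]_m) : 0 <= (v^T *m v) 0 0.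
  by rewrite mxE sumr_ge0 // => j _; rewrite mxE -expr2 sqr_ge0.
have D0 k : 0 <= D 0 k.
  rewrite (diag_entry k VV SE) mulmxA -mulmxA.
  by have := sq_ge0 (P *m (row k V)^T); rewrite trmx_mul trmxK.
pose Q : 'rV[R]_n := \row_k Num.sqrt (D 0 k).
exists (V^T *m diag_mx Q *m V); split.
  split; first by rewrite !trmx_mul trmxK tr_diag_mx mulmxA.
  move=> x; rewrite mulmxA mulmxA -mulmxA -(mulmxA _ (diag_mx Q)).
  pose y := V *m x; have -> : x^T *m V^T = y^T by rewrite trmx_mul.
  rewrite -/y mxE sumr_ge0 // => k _.
  rewrite mul_diag_mx !mxE mulrCA mulr_ge0 ?sqrtr_ge0 //.
  by rewrite -expr2 sqr_ge0.
rewrite SE !mulmxA -(mulmxA _ V V^T) VV mulmx1; congr (_ *m _).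
rewrite -!mulmxA; congr (_ *m _); rewrite mulmx_diag; congr diag_mx.
by apply/rowP => k; rewrite !mxE -expr2 sqr_sqrtr.
Qed.

Lemma svd n (P : 'M[R]_n) : P \in unitmx ->
  exists (U V : 'M[R]_n) (D : 'rV[R]_n), [/\ U^T *m U = 1%:M, V *m V^T = 1%:M,
    P = U *m diag_mx D *m V,
    forall a b : 'I_n, (a <= b)%N -> D 0 b <= D 0 a &
    forall k : 'I_n, 0 < D 0 k /\ singular_value k.+1 P = D 0 k].
Proof.
move=> uP; have [[symS psdS] SS] := psd_sqrtP P.
set S := psd_sqrt _ in symS psdS SS.
have [V [D [VV SE Ds]]] := sym_spectral_sorted symS.
have VtV : V^T *m V = 1%:M by exact: mulmx1C.
have MD : V *m (P^T *m P) *m V^T = diag_mx D *m diag_mx D.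
  rewrite -SS SE !mulmxA VV mul1mx -!mulmxA (mulmxA V) VV mul1mx.
  by rewrite mulmx1.
have D0 k : 0 < D 0 k.
  rewrite lt_def; apply/andP; split; last first.
    by rewrite (diag_entry k VV SE); have := psdS (row k V)^T; rewrite trmxK.
  have : \det (V *m (P^T *m P) *m V^T) != 0.
    rewrite -unitfE -unitmxE !unitmx_mul !unitmx_tr uP /=.
    by have [-> _] := mulmx1_unit VV.
  rewrite MD det_mulmx mulf_eq0 orbb det_diag; apply: contraNneq => Dk.
  by rewrite (bigD1 k) //= Dk mul0r.
pose Di : 'rV[R]_n := \row_k (D 0 k)^-1.
have DDi : diag_mx D *m diag_mx Di = 1%:M.
  by rewrite mulmx_diag; apply/matrixP => a b; rewrite !mxE mulfV // gt_eqF.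
have DiD := mulmx1C DDi.
exists (P *m V^T *m diag_mx Di), V, D; split=> //.
- rewrite !trmx_mul trmxK tr_diag_mx -!mulmxA (mulmxA P^T) (mulmxA V).
  rewrite (mulmxA (V *m _)) MD -mulmxA DDi mulmx1 DiD //.
- by rewrite -(mulmxA _ (diag_mx Di)) DiD mulmx1 -mulmxA VtV mulmx1.
- move=> k; split=> //; rewrite /singular_value -/S SE eigenvalues_diag //=.
  by rewrite (nth_map k) ?size_enum_ord // nth_ord_enum.
Qed.

End SingularValueDecomposition.

(** * Rank-one approximation of the exterior power of a matrix with a singular gap *)

Section RankOne.
Context {R : realType}.

Lemma widen_ord_injective m n (mn : (m <= n)%N) : injective (widen_ord mn).
Proof. by move=> x y /(congr1 val) /= /val_inj. Qed.

(** Indices common to the range of [f] and to the first [i] cancel. Equally many, and at least one,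
    remain on either side: the selected factors are at most [r * c], the replaced ones at least [c],
    so the ratio is at most a positive power of [r]. *)
Lemma prod_top_gap d i (D : 'I_d -> R) (c r : R) (f : 'I_i -> 'I_d)
    (k0 : 'I_i) :
  (i <= d)%N -> 0 < c -> 0 <= r <= 1 ->
  (forall a, 0 <= D a) ->
  (forall a : 'I_d, (a < i)%N -> c <= D a) ->
  (forall a : 'I_d, (i <= a)%N -> D a <= r * c) ->
  injective f -> (i <= f k0)%N ->
  \prod_k D (f k) <= r * \prod_(a < d | (a < i)%N) D a.
Proof.
move=> hid c0 /andP[r0 r1] D0 Dtop Dbot injf fk0.
pose S := [set f k | k in 'I_i]%SET; pose T := [set a : 'I_d | (a < i)%N]%SET.
have cardS : #|S| = i by rewrite card_imset // card_ord.
have cardT : #|T| = i.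
  rewrite -[RHS]card_ord -(card_imset _ (@widen_ord_injective _ _ hid)).
  apply: eq_card => a; rewrite inE; apply/idP/imsetP => [ai|[b _ ->] /=].
    by exists (Ordinal ai) => //; exact/val_inj.
  by rewrite ltn_ord.
have -> : \prod_k D (f k) = \prod_(a in S) D a.
  by rewrite big_imset //= => x y _ _; exact: injf.
have -> : \prod_(a < d | (a < i)%N) D a = \prod_(a in T) D a.
  by apply: eq_bigl => a; rewrite inE.
rewrite (big_setID T) [X in _ <= _ * X](big_setID S) /= finset.setIC.
set m := #|(S :\: T)%SET|.
have cardTS : #|(T :\: S)%SET| = m.
  apply/eqP; rewrite /m -(eqn_add2l #|(T :&: S)%SET|) cardsID finset.setIC
    cardsID.
  by rewrite cardS cardT.
have m0 : (0 < m)%N.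
  rewrite card_gt0; apply/set0Pn; exists (f k0); rewrite !inE -leqNgt fk0 /=.
  by apply/imsetP; exists k0.
have I0 : 0 <= \prod_(a in (T :&: S)%SET) D a by rewrite prodr_ge0.
have ub : \prod_(a in (S :\: T)%SET) D a <= (r * c) ^+ m.
  rewrite /m -prodr_const; apply: ler_prod => a;
    rewrite !inE -leqNgt => /andP[ia _].
  by rewrite D0 Dbot.
have lb : c ^+ m <= \prod_(a in (T :\: S)%SET) D a.
  rewrite -cardTS -prodr_const; apply: ler_prod => a;
    rewrite !inE => /andP[_ ai].
  by rewrite ltW //= Dtop.
rewrite mulrCA ler_wpM2l //; apply: le_trans ub _.
rewrite exprMn; apply: ler_pM lb; rewrite ?exprn_ge0 // ?(ltW c0) //.
by rewrite -[leRHS]expr1; apply: ler_wiXn2l.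
Qed.

Lemma det_le_fact i (A : 'M[R]_i) : (forall a b, `|A a b| <= 1) ->
  `|\det A| <= i`!%:R.
Proof.
move=> A1; apply: le_trans (ler_norm_sum _ _ _) _.
apply: le_trans (_ : \sum_(s : 'S_i) 1 <= _).
  apply: ler_sum => s _; rewrite normrM normrX normrN1 expr1n mul1r.
  by rewrite normr_prod prodr_ile1 // => k _; rewrite normr_ge0 A1.
rewrite sumr_const (_ : #|_| = i`!) //.
by rewrite -[RHS]card_Sn; apply: eq_card => s; rewrite !inE.
Qed.

Lemma l1norm_compound_le i m n (A : 'M[R]_(m, n)) : (forall a b, `|A a b| <= 1)
  ->
  l1norm (compound i A) <=
  (#|{: {ffun 'I_i -> 'I_m}}| * #|{: {ffun 'I_i -> 'I_n}}|)%:R.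
Proof.
move=> A1; rewrite -[leRHS]mulr1; apply: l1norm_le_const => a b.
rewrite mxE normrM normfV [ `|_%:R|]ger0_norm ?ler0n // mulrC ler_pdivrMr
  ?ltr0n ?fact_gt0 //.
by rewrite mul1r; apply: det_le_fact => x y; rewrite mxE.
Qed.

Lemma orthogonal_entry_le1 n (U : 'M[R]_n) : U *m U^T = 1%:M ->
  forall a b, `|U a b| <= 1.
Proof.
move=> UU a b; rewrite -(ler_pXn2r (ltn0Sn 1)) ?nnegrE // real_normK ?num_real
  //.
have := congr1 (fun M : 'M[R]_n => M a a) UU;
  rewrite !mxE eqxx mulr1n expr1n => <-.
rewrite (bigD1 b) //= mxE -expr2 lerDl sumr_ge0 // => k _.
by rewrite mxE -expr2 sqr_ge0.
Qed.

(** The compound of a diagonal matrix is that of the identity with row [f] multiplied by the product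
    of the entries selected by [f]. Injective maps into the first [i] indices give exactly [s], the
    other injective ones at most [s * r], and the non-injective ones a vanishing minor. *)
Lemma compound_diag_gap i d (D : 'rV[R]_d) (c r : R) :
  (i <= d)%N -> 0 < c -> 0 <= r <= 1 ->
  (forall a, 0 <= D 0 a) ->
  (forall a : 'I_d, (a < i)%N -> c <= D 0 a) ->
  (forall a : 'I_d, (i <= a)%N -> D 0 a <= r * c) ->
  let s := \prod_(a < d | (a < i)%N) D 0 a in
  l1norm (compound i (diag_mx D) - s *: compound i (pid_mx i : 'M[R]_d)) <=
  (#|{: {ffun 'I_i -> 'I_d}}| * #|{: {ffun 'I_i -> 'I_d}}|)%:R * (s * r).
Proof.
move=> hid c0 r01 D0 Dtop Dbot /=; set s := \prod_(_ < d | _) _.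
have s0 : 0 <= s by rewrite prodr_ge0.
have [r0 r1] := andP r01.
apply: l1norm_le_const => a b; rewrite !mxE.
set f := multi a; set g := multi b.
have detD (D' : 'rV[R]_d) : \det (mxsub f g (diag_mx D')) =
    (\prod_k D' 0 (f k)) * \det (mxsub f g (1%:M : 'M[R]_d)).
  have -> : mxsub f g (diag_mx D') = diag_mx (\row_k D' 0 (f k)) *m
      mxsub f g (1%:M : 'M[R]_d).
    by apply/matrixP => x y; rewrite mul_diag_mx !mxE mulr_natr.
  by rewrite det_mulmx det_diag; congr (_ * _); apply: eq_bigr => k _;
    rewrite mxE.
have -> : pid_mx i = diag_mx (\row_(x < d) ((x < i)%N)%:R) :> 'M[R]_d.
  apply/matrixP => x y; rewrite !mxE -val_eqE /=.
  by case: eqP => [->|_]; rewrite ?mulr1n ?mulr0n.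
rewrite !detD [X in _ - X]mulrCA -mulrBr [s * (_ * _)]mulrA -mulrBl.
rewrite normrM normfV [ `|_%:R|]ger0_norm ?ler0n // mulrC ler_pdivrMr ?ltr0n
  ?fact_gt0 //.
have det1 : `|\det (mxsub f g (1%:M : 'M[R]_d))| <= i`!%:R.
  by apply: det_le_fact => x y; rewrite !mxE; case: (_ == _);
    rewrite ?normr1 ?normr0.
rewrite normrM; have [injf|ninjf] := boolP (injectiveb f); last first.
  suff -> : \det (mxsub f g (1%:M : 'M[R]_d)) = 0.
    by rewrite normr0 mulr0 !mulr_ge0.
  have /injectivePn[x [y xy fxy]] := ninjf.
  by apply: (determinant_alternate xy) => z; rewrite !mxE fxy.
move/injectiveP: injf => injf; apply: ler_pM => //.
have [/forallP ftop|] := boolP [forall k, (f k < i)%N].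
  have -> : \prod_k (\row_(x < d) ((x < i)%N)%:R : 'rV[R]_d) 0 (f k) = 1.
    by apply: big1 => k _; rewrite mxE ftop.
  suff -> : \prod_k D 0 (f k) = s by rewrite mulr1 subrr normr0 mulr_ge0.
  have -> : \prod_k D 0 (f k) = \prod_(a in [set f k | k in 'I_i]%SET) D 0 a.
    by rewrite big_imset //= => x y _ _; exact: injf.
  apply: eq_bigl => x.
  suff /eqP -> : [set f k | k in 'I_i]%SET == [set x : 'I_d | (x < i)%N]%SET.
    by rewrite inE.
  rewrite eqEcard; apply/andP; split.
    by apply/fintype.subsetP => _ /imsetP[k _ ->]; rewrite inE.
  rewrite card_imset // card_ord -[leqRHS]card_ord -(card_imset _
    (@widen_ord_injective _ _ hid)).
  apply: subset_leq_card; apply/fintype.subsetP => y; rewrite inE => yi.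
  by apply/imsetP; exists (Ordinal yi) => //; exact/val_inj.
rewrite negb_forall => /existsP[k0]; rewrite -leqNgt => fk0.
have -> : \prod_k (\row_(x < d) ((x < i)%N)%:R : 'rV[R]_d) 0 (f k) = 0.
  by rewrite (bigD1 k0) //= mxE ltnNge fk0 mul0r.
rewrite mulr0 subr0 ger0_norm ?prodr_ge0 // mulrC.
exact: (prod_top_gap hid c0 r01 D0 Dtop Dbot injf fk0).
Qed.

(** In [P = U D V], the compound of [D] is close to a multiple of that of [pid_mx i], which factors
    as [J *m J^T] and so has a rank-one compound. The functional is kept in the form [coplucker N]
    with independent rows so that the kernel of [N] later provides a [(d - i)]-plane. *)
Lemma compound_rank1_approx i d : (1 <= i <= d - 1)%N ->
  exists2 K : R, 0 < K & forall P : 'M[R]_d, P \in unitmx ->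
  exists (x : 'cV[R]_#|{: {ffun 'I_i -> 'I_d}}|) (N : 'M[R]_(i, d)),
    row_free N /\
    l1norm (compound i P - x *m coplucker N) <=
      K * (singular_value i.+1 P / singular_value i P) * l1norm (compound i P).
Proof.
move=> /andP[i1 id1].
have hid : (i < d)%N by lia.
have jd : (i.-1 < d)%N by lia.
pose k := #|{: {ffun 'I_i -> 'I_d}}|.
have k0 : (0 < k)%N by rewrite /k card_ffun !card_ord expn_gt0; apply/orP;
  left; lia.
have kk0 : 0 < (k * k)%:R :> R by rewrite ltr0n muln_gt0 k0.
set kap : R := (k * k)%:R in kk0.
have fact0 : 0 < i`!%:R :> R by rewrite ltr0n fact_gt0.
exists (kap ^+ 5 * i`!%:R); first by rewrite mulr_gt0 // exprn_gt0.
move=> P uP; have [U [V [D [UU VV PE Ds Dpos]]]] := svd uP.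
have UU' : U *m U^T = 1%:M by exact: mulmx1C.
have VV' : V^T *m V = 1%:M by exact: mulmx1C.
(* Singular values count from 1 and [D] from 0, so the relevant entries are those of index [i] and
   [i.-1]. *)
have [_ ->] := Dpos (Ordinal hid).
have [Dc] := Dpos (Ordinal jd); rewrite /= prednK // => ->.
set c := D 0 (Ordinal jd) in Dc *; set r := D 0 (Ordinal hid) / c.
have Di : D 0 (Ordinal hid) = r * c by rewrite divfK ?gt_eqF.
have r01 : 0 <= r <= 1.
  rewrite divr_ge0 ?(ltW Dc) ?(ltW (Dpos _).1) //= ler_pdivrMr // mul1r.
  by apply: Ds => /=; lia.
have r0 : 0 <= r by case/andP: r01.
have D0 a : 0 <= D 0 a by exact: ltW (Dpos a).1.
have Dtop (a : 'I_d) : (a < i)%N -> c <= D 0 a.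
  by move=> ai; apply: Ds => /=; lia.
have Dbot (a : 'I_d) : (i <= a)%N -> D 0 a <= r * c.
  by move=> ia; rewrite -Di; exact: Ds.
have := compound_diag_gap (ltnW hid) Dc r01 D0 Dtop Dbot.
set s := \prod_(_ < d | _) _ => /=; rewrite -/k -/kap => gap.
have s0 : 0 <= s by rewrite prodr_ge0.
have cU : l1norm (compound i U) <= kap.
  exact: l1norm_compound_le (orthogonal_entry_le1 UU').
have cV : l1norm (compound i V) <= kap.
  exact: l1norm_compound_le (orthogonal_entry_le1 VV).
have cUT : l1norm (compound i U^T) <= kap.
  apply: l1norm_compound_le; apply: orthogonal_entry_le1.
  by rewrite trmxK.
have cVT : l1norm (compound i V^T) <= kap.
  apply: l1norm_compound_le; apply: orthogonal_entry_le1.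
  by rewrite trmxK.
pose J : 'M[R]_(d, i) := pid_mx i.
have JJ : J *m J^T = pid_mx i.
  by rewrite /J tr_pid_mx mul_pid_mx !minnn.
have JJ1 : J^T *m J = 1%:M.
  by rewrite /J tr_pid_mx mul_pid_mx minnn (minn_idPr (ltnW hid)) pid_mx_1.
(* [s] divided by [i!] is a diagonal entry of the compound of [D = U^T P V^T]. Bounding it through
   [P] contributes [i!] and two factors [kap], besides the three coming from [U], [V] and the gap
   estimate. *)
have s_le : s <= i`!%:R * (kap ^+ 2 * l1norm (compound i P)).
  pose f0 : {ffun 'I_i -> 'I_d} := [ffun x => widen_ord (ltnW hid) x].
  have entry : compound i (diag_mx D) (enum_rank f0) (enum_rank f0) = i`!%:R^-1
    * s.
    rewrite mxE /multi enum_rankK; congr (_ * _).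
    have -> : mxsub f0 f0 (diag_mx D) = diag_mx (\row_x D 0 (f0 x)).
      apply/matrixP => x y; rewrite !mxE !ffunE.
      by rewrite (inj_eq (@widen_ord_injective _ _ (ltnW hid))).
    rewrite det_diag /s (big_ord_narrow (ltnW hid)).
    by apply: eq_bigr => x _; rewrite mxE ffunE.
  have : i`!%:R^-1 * s <= kap ^+ 2 * l1norm (compound i P).
    rewrite -entry; apply: le_trans (ler_norm _) _.
    apply: le_trans (entry_le_l1norm _ _ _) _.
    have -> : diag_mx D = U^T *m P *m V^T.
      by rewrite PE !mulmxA UU mul1mx -mulmxA VV mulmx1.
    rewrite !compoundM; apply: le_trans (l1normM _ _) _.
    rewrite expr2 -mulrA [leRHS]mulrC.
    apply: ler_pM; rewrite ?l1norm_ge0 //.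
    by apply: le_trans (l1normM _ _) _; rewrite ler_wpM2r ?l1norm_ge0.
  by rewrite mulrC ler_pdivrMr // [leRHS]mulrC.
exists ((s / i`!%:R) *: plucker (U *m J)), (J^T *m V); split.
  apply/row_freeP; exists (V^T *m J).
  by rewrite mulmxA -(mulmxA _ V) VV mulmx1 JJ1.
have -> : compound i P - ((s / i`!%:R) *: plucker (U *m J)) *m coplucker (J^T
  *m V)
    = compound i U *m (compound i (diag_mx D) - s *: compound i (pid_mx i :
      'M[R]_d))
      *m compound i V.
  rewrite -scalemxAl -scalerA -compound_mul_thin.
  rewrite mulmxA -(mulmxA U) JJ !compoundM PE !compoundM.
  by rewrite mulmxBr mulmxBl -scalemxAr -scalemxAl.
apply: le_trans (l1normM _ _) _.
apply: (@le_trans _ _ (kap * (kap * (s * r)) * kap)).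
  apply: ler_pM; rewrite ?l1norm_ge0 //; apply: le_trans (l1normM _ _) _.
  by apply: ler_pM; rewrite ?l1norm_ge0.
rewrite (_ : kap * (kap * (s * r)) * kap = kap ^+ 3 * r * s); last by ring.
rewrite (_ : kap ^+ 5 * _ * _ * _ = kap ^+ 3 * r *
  (i`!%:R * (kap ^+ 2 * l1norm (compound i P)))); last by ring.
by rewrite ler_wpM2l // mulr_ge0 // exprn_ge0 // ltW.
Qed.

End RankOne.

(** * Supermultiplicativity of norms of products *)

Section Growth.
Context {R : realType} {T : Type}.

Lemma expr_small (x e : R) : 0 <= x < 1 -> 0 < e -> exists n, x ^+ n < e.
Proof.
move=> /andP[x0 x1] e0.
have nx : `|x| < 1 by rewrite ger0_norm.
have /cvgrPdist_lt/(_ e e0) := cvg_expr nx.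
move=> [n _ /(_ n (leqnn n))] /=; rewrite sub0r normrN ger0_norm ?exprn_ge0 //.
by exists n.
Qed.

Variables (N : seq T -> R) (K C tau : R).
Hypothesis N_gt0 : forall u, 0 < N u.
Hypothesis N_cat : forall u v, N (u ++ v) <= N u * N v.
Hypothesis N_nil : N [::] <= K.
Hypothesis N_letter : forall a, N [:: a] <= K.
Hypothesis N_rcons : forall u a, N u <= K * N (rcons u a).
Hypothesis N_cons : forall a u, N u <= K * N (a :: u).
Hypothesis K_ge1 : 1 <= K.
Hypothesis C_ge0 : 0 <= C.
Hypothesis tau01 : 0 < tau < 1.
Hypothesis N_middle : forall u v w, (0 < size v)%N ->
  N (u ++ v) * N (v ++ w) <=
  N (u ++ v ++ w) * N v + C * tau ^+ size v * (N u * N v ^+ 2 * N w).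

(** The loss of multiplicativity at a cut, at most 1; the aim is a uniform positive lower bound. *)
Let alpha u v := N (u ++ v) / (N u * N v).
(** The sum of the geometric series of the one-letter errors [C * K ^+ 2 * tau ^+ k]. *)
Let B := C * K ^+ 2 / (1 - tau).

Let K_gt0 : 0 < K. Proof. exact: lt_le_trans K_ge1. Qed.
Let tau_gt0 : 0 < tau. Proof. by case/andP: tau01. Qed.
Let tau_lt1 : tau < 1. Proof. by case/andP: tau01. Qed.
Let tauX_ge0 n : 0 <= tau ^+ n. Proof. exact: exprn_ge0 (ltW tau_gt0). Qed.
Let CK_ge0 : 0 <= C * K ^+ 2.
Proof. by rewrite mulr_ge0 // exprn_ge0 // ltW. Qed.
Let B_ge0 : 0 <= B.
Proof. by rewrite divr_ge0 ?mulr_ge0 ?exprn_ge0 ?subr_ge0 // ltW. Qed.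

Lemma alpha_ge0 u v : 0 <= alpha u v.
Proof. by rewrite divr_ge0 ?mulr_ge0 // ltW. Qed.

Lemma alphaK u v : N (u ++ v) = alpha u v * (N u * N v).
Proof. by rewrite divfK // mulf_neq0 // gt_eqF. Qed.

Lemma alpha_letter_r v a : 1 <= K ^+ 2 * alpha v [:: a].
Proof.
rewrite mulrA ler_pdivlMr ?mulr_gt0 // mul1r cats1.
rewrite (_ : K ^+ 2 * _ = K * N (rcons v a) * K); last by ring.
by rewrite ler_pM ?(ltW (N_gt0 _)).
Qed.

Lemma alpha_letter_l v a : 1 <= K ^+ 2 * alpha [:: a] v.
Proof.
rewrite mulrA ler_pdivlMr ?mulr_gt0 // mul1r /=.
rewrite (_ : K ^+ 2 * _ = K * (K * N (a :: v))); last by ring.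
by rewrite ler_pM ?(ltW (N_gt0 _)).
Qed.

(** Appending one letter to [v] hardly lowers the value at the cut: [N_middle] with a one-letter
    [w], divided by [alpha v [:: a] >= K ^- 2], gives the error [C * K ^+ 2 * tau ^+ size v], and
    these errors are summable. *)
Lemma alpha_extend_r u v w : (0 < size v)%N ->
  alpha u v <= alpha u (v ++ w) + B * tau ^+ size v.
Proof.
elim: w v => [|a w IH] v v0.
  by rewrite cats0 lerDl mulr_ge0.
have := IH (rcons v a) _; rewrite size_rcons cat_rcons => /(_ isT) step.
suff one : alpha u v <= alpha u (rcons v a) + C * K ^+ 2 * tau ^+ size v.
  apply: le_trans one _; apply: le_trans (lerD step (lexx _)) _.
  rewrite -addrA lerD2l exprS (_ : C * K ^+ 2 = B * (1 - tau)); last first.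
    by rewrite divfK // subr_eq0 gt_eqF.
  by rewrite le_eqVlt; apply/orP; left; apply/eqP; ring.
have al := alpha_letter_r v a.
have al0 : 0 <= alpha v [:: a] by exact: alpha_ge0.
have mid : alpha u v * alpha v [:: a] <=
    alpha u (rcons v a) * alpha v [:: a] + C * tau ^+ size v.
  have := N_middle u [:: a] v0; rewrite -(cats1 v a).
  rewrite (alphaK u v) (alphaK v [:: a]) (alphaK u (v ++ [:: a])).
  rewrite (alphaK v [:: a]) => h.
  have p0 : 0 < N u * N v ^+ 2 * N [:: a] by rewrite !mulr_gt0 ?exprn_gt0.
  rewrite -(ler_pM2r p0) mulrDl; apply: le_trans (le_trans _ h) _.
    by rewrite le_eqVlt; apply/orP; left; apply/eqP; ring.
  by rewrite le_eqVlt; apply/orP; left; apply/eqP; ring.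
have K20 : 0 <= K ^+ 2 by rewrite exprn_ge0 // ltW.
have := ler_wpM2l K20 mid => {}mid.
have d0 : 0 <= C * tau ^+ size v by rewrite mulr_ge0.
have [le|gt] := leP (alpha u v) (alpha u (rcons v a)).
  apply: le_trans le _; rewrite lerDl.
  exact: mulr_ge0.
have dif : alpha u v - alpha u (rcons v a) <=
  (K ^+ 2 * alpha v [:: a]) * (alpha u v - alpha u (rcons v a)).
  by rewrite ler_peMl // subr_ge0 ltW.
rewrite -lerBlDl; apply: le_trans dif _.
rewrite (_ : C * K ^+ 2 * _ = K ^+ 2 * (C * tau ^+ size v)); last by ring.
by move: mid; rewrite mulrDr -lerBlDl; apply: le_trans; rewrite le_eqVlt;
  apply/orP; left; apply/eqP; ring.
Qed.

Lemma alpha_extend_l u v w : (0 < size v)%N ->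
  alpha v w <= alpha (u ++ v) w + B * tau ^+ size v.
Proof.
elim/last_ind: u v => [|u a IH] v v0.
  by rewrite cat0s lerDl mulr_ge0.
have := IH (a :: v) isT; rewrite /= -cat_rcons => step.
suff one : alpha v w <= alpha (a :: v) w + C * K ^+ 2 * tau ^+ size v.
  apply: le_trans one _; apply: le_trans (lerD step (lexx _)) _.
  rewrite -addrA lerD2l exprS (_ : C * K ^+ 2 = B * (1 - tau)); last first.
    by rewrite divfK // subr_eq0 gt_eqF.
  by rewrite le_eqVlt; apply/orP; left; apply/eqP; ring.
have al := alpha_letter_l v a.
have al0 : 0 <= alpha [:: a] v by exact: alpha_ge0.
have mid : alpha v w * alpha [:: a] v <=
    alpha (a :: v) w * alpha [:: a] v + C * tau ^+ size v.
  have := N_middle [:: a] w v0; rewrite catA.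
  rewrite (alphaK v w) (alphaK ([:: a] ++ v) w) (alphaK [:: a] v) => h.
  have p0 : 0 < N [:: a] * N v ^+ 2 * N w by rewrite !mulr_gt0 ?exprn_gt0.
  rewrite -(ler_pM2r p0) mulrDl; apply: le_trans (le_trans _ h) _.
    by rewrite le_eqVlt; apply/orP; left; apply/eqP; ring.
  by rewrite le_eqVlt; apply/orP; left; apply/eqP; rewrite /=; ring.
have K20 : 0 <= K ^+ 2 by rewrite exprn_ge0 // ltW.
have := ler_wpM2l K20 mid => {}mid.
have [le|gt] := leP (alpha v w) (alpha (a :: v) w).
  apply: le_trans le _; rewrite lerDl.
  exact: mulr_ge0.
have dif : alpha v w - alpha (a :: v) w <=
  (K ^+ 2 * alpha [:: a] v) * (alpha v w - alpha (a :: v) w).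
  by rewrite ler_peMl // subr_ge0 ltW.
rewrite -lerBlDl; apply: le_trans dif _.
rewrite (_ : C * K ^+ 2 * _ = K ^+ 2 * (C * tau ^+ size v)); last by ring.
by move: mid; rewrite mulrDr -lerBlDl; apply: le_trans; rewrite le_eqVlt;
  apply/orP; left; apply/eqP; ring.
Qed.

(** The total product is unchanged; each letter crossing the cut costs a factor of at most [K ^+ 2]
    in the denominator. *)
Lemma alpha_shift p x q : alpha (p ++ x) q <= K ^+ (2 * size x) * alpha p (x ++
  q).
Proof.
elim: x p => [|a x IH] p; first by rewrite cats0 mul1r.
have := IH (rcons p a); rewrite cat_rcons => /le_trans; apply.
rewrite mulnS exprD [_ ^+ 2 * _]mulrC -mulrA ler_wpM2l ?exprn_ge0 ?(ltW K_gt0)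
  //.
rewrite /alpha cat_rcons -[a :: (x ++ q)]/((a :: x) ++ q).
set z := N (p ++ _); rewrite mulrCA ler_pM2l ?N_gt0 //.
rewrite -[leLHS]mul1r ler_pdivrMr ?mulr_gt0 //.
rewrite mulrAC ler_pdivlMr ?mulr_gt0 // mul1r.
rewrite (_ : K ^+ 2 * _ = (K * N (rcons p a)) * (K * N (x ++ q))); last by ring.
apply: ler_pM; rewrite ?(ltW (N_gt0 _)) //=.
apply: le_trans (N_cat [:: a] _) _; rewrite ler_wpM2r ?(ltW (N_gt0 _)) //.
Qed.

Lemma N_ge_pow u : K ^- size u <= N u.
Proof.
elim: u => [|a u IH] /=.
  rewrite expr0 invr1 -(ler_pM2r (N_gt0 [::])) mul1r.
  exact: N_cat [::] [::].
rewrite exprS invfM; apply: le_trans (_ : K^-1 * N u <= _).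
  by rewrite ler_pM2l ?invr_gt0.
by rewrite mulrC ler_pdivrMr // mulrC.
Qed.

Lemma N_le_pow u : N u <= K ^+ (size u).+1.
Proof.
elim: u => [|a u IH]; first by rewrite expr1.
apply: le_trans (N_cat [:: a] u) _; rewrite exprS ler_pM ?(ltW (N_gt0 _)) //.
Qed.

Lemma N_cat_ge u v : N u <= K ^+ size v * N (u ++ v).
Proof.
elim: v u => [|a v IH] u; first by rewrite cats0 mul1r.
rewrite exprS -mulrA; apply: le_trans (N_rcons u a) _.
by rewrite ler_wpM2l ?(ltW K_gt0) // -cat_rcons IH.
Qed.

(** Halving a window of length [2 ^ j.+1] gains the factor [tau ^+ (2 ^ j) = rho ^+ (2 ^ j.+1)], so
    every dyadic level contributes one more [rho] per letter. The normalisation [L * N u] makes the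
    recursion multiplicative, [L] absorbing the constant of each cut. *)
Lemma window_bound (L rho : R) (J j : nat) p u q :
  1 + 2 * B <= L -> rho ^+ 2 = tau -> 0 <= rho -> (size u = 2 ^ j)%N -> (2 ^ j
    <= J)%N ->
  (forall u1 u2, u = u1 ++ u2 -> alpha (p ++ u1) (u2 ++ q) <= tau ^+ J) ->
  L * N u <= (L * K * rho ^+ j) ^+ (2 ^ j).
Proof.
move=> LB rho2 rho0.
have L0 : 0 <= L by apply: le_trans LB; rewrite addr_ge0 // mulr_ge0.
elim: j p u q => [|j IH] p u q su jJ Hu.
  case: u su Hu => [//|a [|//]] _ _; rewrite expr0 mulr1 expr1.
  by rewrite ler_wpM2l.
have su1 : size (take (2 ^ j) u) = (2 ^ j)%N.
  by rewrite size_takel // su leq_exp2l.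
have su2 : size (drop (2 ^ j) u) = (2 ^ j)%N.
  by rewrite size_drop su expnS mul2n -addnn addnK.
have jJ' : (2 ^ j <= J)%N by apply: leq_trans jJ; rewrite leq_exp2l.
set u1 := take _ u in su1; set u2 := drop _ u in su2.
have uE : u = u1 ++ u2 by rewrite cat_take_drop.
have h1 := IH p u1 (u2 ++ q) su1 jJ'.
have {}h1 : L * N u1 <= (L * K * rho ^+ j) ^+ (2 ^ j).
  by apply: h1 => v1 v2 E; rewrite catA; apply: Hu; rewrite uE E catA.
have h2 := IH (p ++ u1) u2 q su2 jJ'.
have {}h2 : L * N u2 <= (L * K * rho ^+ j) ^+ (2 ^ j).
  by apply: h2 => v1 v2 E; rewrite -catA; apply: Hu; rewrite uE E catA.
have j0 : (0 < 2 ^ j)%N by rewrite expn_gt0.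
(* Cutting off the surroundings [q] and [p] costs one extension error each; together with the
   hypothesis on cuts this makes [1 + 2 * B]. *)
have a12 : alpha u1 u2 <= L * tau ^+ (2 ^ j).
  have e1 : alpha u1 u2 <= alpha u1 (u2 ++ q) + B * tau ^+ (2 ^ j).
    by rewrite -[X in tau ^+ X]su2; apply: alpha_extend_r; rewrite su2.
  have e2 : alpha u1 (u2 ++ q) <= alpha (p ++ u1) (u2 ++ q) + B * tau ^+ (2 ^
    j).
    by rewrite -[X in tau ^+ X]su1; apply: alpha_extend_l; rewrite su1.
  have e3 := Hu u1 u2 uE.
  have e4 : tau ^+ J <= tau ^+ (2 ^ j) by rewrite ler_wiXn2l // ?ltW.
  apply: le_trans (_ : (1 + 2 * B) * tau ^+ (2 ^ j) <= _).
    by rewrite mulrDl mul1r; lra.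
  by rewrite ler_wpM2r // exprn_ge0 // ltW.
have -> : (L * K * rho ^+ j.+1) ^+ (2 ^ j.+1) =
    tau ^+ (2 ^ j) * ((L * K * rho ^+ j) ^+ (2 ^ j) * (L * K * rho ^+ j) ^+ (2
      ^ j)).
  rewrite expnS exprM -!exprMn -rho2; congr (_ ^+ _).
  by rewrite (exprS rho j); ring.
rewrite uE alphaK mulrCA.
apply: le_trans (_ : L * tau ^+ (2 ^ j) * (L * (N u1 * N u2)) <= _).
  by rewrite ler_wpM2r // !mulr_ge0 // ltW.
rewrite (_ : L * tau ^+ _ * _ = tau ^+ (2 ^ j) * ((L * N u1) * (L * N u2)));
  last by ring.
rewrite ler_wpM2l ?exprn_ge0 ?(ltW tau_gt0) //.
by apply: ler_pM; rewrite ?mulr_ge0 // ltW.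
Qed.

(* If [alpha u v] were tiny, it would be tiny at all nearby cut points; then
   inside a window of length [2 ^ k] every cut loses a definite factor, and
   dyadic subdivision makes the window shrink faster than [K ^- (2 ^ k)]. *)
Lemma N_supermult : exists2 delta : R, 0 < delta &
  forall u v, delta * (N u * N v) <= N (u ++ v).
Proof.
pose L := 1 + 2 * B.
have L1 : 1 <= L by rewrite lerDl mulr_ge0.
have L0 : 0 < L by exact: lt_le_trans L1.
pose rho := Num.sqrt tau.
have rho2 : rho ^+ 2 = tau by rewrite sqr_sqrtr // ltW.
have rho0 : 0 <= rho by exact: sqrtr_ge0.
have rho1 : 0 <= rho < 1.
  by rewrite rho0 /= -(ltr_pXn2r (ltn0Sn 1)) ?nnegrE // rho2 expr1n.
(* With this [k] the window bound falls below [K ^- J], which bounds from below the norm of every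
   word of length [J]. *)
have [k hk] : exists k, rho ^+ k < (L * K * K)^-1.
  by apply: expr_small; rewrite // invr_gt0 !mulr_gt0.
pose J := (2 ^ k)%N.
have J0 : (0 < J)%N by rewrite expn_gt0.
have KJ0 : 0 < K ^+ (2 * J) by rewrite exprn_gt0.
(* The power of [K] pays for moving the cut anywhere in a window of length [J], and also covers the
   words [v] shorter than [J]. *)
pose delta := tau ^+ J / K ^+ (2 * J).+1.
have d0 : 0 < delta by rewrite divr_gt0 // exprn_gt0.
exists delta => // u v.
suff le : delta <= alpha u v.
  by rewrite alphaK ler_wpM2r // mulr_ge0 // ltW.
have [vJ|Jv] := ltnP (size v) J.
  rewrite /alpha ler_pdivlMr ?mulr_gt0 //.
  apply: (@le_trans _ _ (K ^- (2 * J).+1 * (K ^+ size v * N (u ++ v) * K ^+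
    (size v).+1))).
    apply: ler_pM; [exact: ltW|by rewrite mulr_ge0 // ltW| |].
      by rewrite /delta ler_piMl ?invr_ge0 ?exprn_ge0 ?(ltW K_gt0) //
        exprn_ile1 // ltW.
    by apply: ler_pM; rewrite ?(ltW (N_gt0 _)) ?N_cat_ge ?N_le_pow.
  rewrite mulrC ler_pdivrMr ?exprn_gt0 // mulrAC -exprD mulrC.
  rewrite ler_wpM2l ?(ltW (N_gt0 _)) // ler_weXn2l //.
  by rewrite addnS ltnS mul2n -addnn leq_add // ltnW.
apply: contrapT => /negP; rewrite -ltNge => small.
pose w := take J v; pose q := drop J v.
have sw : size w = J by rewrite size_takel.
have vE : v = w ++ q by rewrite cat_take_drop.
have cut u1 u2 : w = u1 ++ u2 -> alpha (u ++ u1) (u2 ++ q) <= tau ^+ J.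
  move=> wE; apply: le_trans (alpha_shift u u1 (u2 ++ q)) _.
  rewrite catA -wE -vE; apply: (@le_trans _ _ (K ^+ (2 * J).+1 * delta)).
    apply: ler_pM; rewrite ?exprn_ge0 ?(ltW K_gt0) ?alpha_ge0 ?(ltW small) //.
    rewrite ler_weXn2l //; apply: leqW.
    by rewrite leq_pmul2l // -sw wE size_cat leq_addr.
  by rewrite /delta mulrC divfK // gt_eqF // exprn_gt0.
have := window_bound (lexx L) rho2 rho0 sw (leqnn J) cut; apply/negP.
rewrite -ltNge; apply: (@lt_le_trans _ _ (K ^- J)).
  rewrite -exprVn -/J ltrXn2r -?lt0n ?J0 //.
    by rewrite !mulr_ge0 ?exprn_ge0 // ltW.
  rewrite (_ : K^-1 = L * K * (L * K * K)^-1).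
    by rewrite ltr_pM2l ?mulr_gt0.
  by field; rewrite !gt_eqF.
rewrite -sw; apply: le_trans (N_ge_pow w) _.
by rewrite ler_peMl // ltW.
Qed.

End Growth.

(** * Topology of the Grassmannian *)

Section Components.

(* The components of a finite union of closed connected sets are finitely many
   and closed, hence equal to their closures. *)
Lemma finite_components_cover (S : ptopologicalType) (T : topologicalType)
    (p : S -> T) (K : set S) (U : set T) : compact K ->
  (forall x, K x -> exists (W : set S) (B : set T),
    [/\ open W, W x, p @` W `<=` B°, closed B /\ connected B & B `<=` U]) ->
  exists C : set T, [/\ p @` K `<=` C°, C `<=` U, closed C
    & finitely_many_separated_components C].
Proof.
rewrite compact_cover => cK loc.
have {loc}/choice[f fP] x : exists WB : set S * set T, K x ->
    [/\ open WB.1, WB.1 x, p @` WB.1 `<=` WB.2°, closed WB.2 /\ connected WB.2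
      & WB.2 `<=` U].
  have [Kx|nKx] := pselect (K x); last by exists (set0, set0).
  by have [W [B WB]] := loc x Kx; exists (W, B).
have [|x Kx|D DK KD] := cK S K (fun x => (f x).1).
- by move=> x /fP[].
- by exists x => //; have [] := fP x Kx.
pose C := \bigcup_(x in [set` D]) (f x).2.
have KDin x : x \in D -> K x by move=> /DK /set_mem.
have closedC : closed C.
  apply: closed_bigcup; first exact: finite_fset.
  by move=> x /= /KDin /fP[_ _ _ []].
exists C; split=> //.
- move=> _ [x Kx <-]; have [y /= yD fyx] := KD x Kx.
  have [_ _ sub _ _] := fP y (KDin y yD).
  apply: (@interiorS _ (f y).2); first by move=> z fz; exists y.
  by apply: sub; exists x.
- move=> z [x /= /KDin /fP[_ _ _ _ sub] fz]; exact: sub.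
split.
  apply: (@sub_finite_set _ _ ((fun x => connected_component C (p x)) @` [set`
    D])).
    move=> _ [z [x /= xD fz] <-]; exists x => //.
    have [_ Wx sub [_ conn] _] := fP x (KDin x xD).
    apply: same_connected_component; exists (f x).2 => //; split=> //.
      by apply: interior_subset; apply: sub; exists x.
    by move=> y fy; exists x.
  by apply: finite_image; exact: finite_fset.
move=> _ _ [x Cx <-] [y Cy <-] [z []].
rewrite -!(closure_id _).1; try exact: component_closed.
move=> xz yz; rewrite (same_connected_component xz).
by rewrite (same_connected_component yz).
Qed.

End Components.

Lemma mx_bounded_closed_compact (R : realType) m n (A : set 'M[R]_(m, n)) (c :
  R) :
  (forall M, A M -> forall a b, `|M a b| <= c) -> closed A -> compact A.
Proof.
move=> Ac clA.
have cvec : continuous (vec_mx : 'rV[R]_(m * n) -> 'M[R]_(m, n)).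
  apply: continuous_mx => a b;
    have -> : (fun v : 'rV[R]_(m * n) => vec_mx v a b)
      = (fun v => v 0 (mxvec_index a b)) by apply/funext => v; rewrite mxE.
  exact: coord_continuous.
have -> : A = vec_mx @` (vec_mx @^-1` A).
  apply/seteqP; split=> [M AM|_ [v Av <-]] //.
  by exists (mxvec M); rewrite /preimage /= mxvecK.
apply: continuous_compact; first exact: continuous_subspaceT.
apply: bounded_closed_compact; last by apply: preimage_closed => // ? _;
  exact: cvec.
exists `|c|; split; first exact: num_real.
move=> x cx v Av /=; rewrite [leLHS]/Num.Def.normr /= mx_normrE.
apply/bigmax_leP; split; first exact: le_trans (ltW cx).
move=> [j k] _ /=; rewrite ord1; case/mxvec_indexP: k => a b.
have := Ac _ Av a b; rewrite mxE => /le_trans; apply.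
exact: le_trans (ler_norm _) (ltW cx).
Qed.

(** * Frames as coordinates on the Grassmannian: separation, compactness, connected
    neighbourhoods *)

Section Frames.
Context {R : realType} {i d : nat}.
Implicit Types (M : 'M[R]_(d, i)) (E : Grass R i d).

Definition cols M : seq 'cV[R]_d := [seq col j M | j <- enum 'I_i].

Lemma sum_cols M (k : 'cV[R]_i) : \sum_j k j 0 *: col j M = M *m k.
Proof.
apply/matrixP => a b; rewrite summxE mxE; apply: eq_bigr => j _.
by rewrite !mxE mulrC !ord1.
Qed.

Lemma mem_cols M (v : 'cV[R]_d) :
  v \in <<cols M>>%VS <-> exists k : 'cV[R]_i, v = M *m k.
Proof.
have szc : size (cols M) == i by rewrite size_map size_enum_ord.
have nthc (j : 'I_i) : (Tuple szc)`_j = col j M.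
  by rewrite /= (nth_map j) ?size_enum_ord // nth_ord_enum.
split=> [vM|[k ->]].
  have vM' : v \in <<Tuple szc>>%VS by [].
  exists (\col_j coord (Tuple szc) j v); rewrite -sum_cols {1}(coord_span vM').
  by apply: eq_bigr => j _; rewrite mxE nthc.
rewrite -sum_cols; apply: memv_suml => j _; apply: memvZ; apply: memv_span.
by apply/mapP; exists j => //; rewrite mem_enum.
Qed.

Lemma framesP M : frames M <-> forall k : 'cV[R]_i, M *m k = 0 -> k = 0.
Proof.
have szc : size (cols M) == i by rewrite size_map size_enum_ord.
have nthc (j : 'I_i) : (Tuple szc)`_j = col j M.
  by rewrite /= (nth_map j) ?size_enum_ord // nth_ord_enum.
have sumE (k : 'cV[R]_i) : \sum_(j < i) k j 0 *: (Tuple szc)`_j = M *m k.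
  by rewrite -sum_cols; apply: eq_bigr => j _; rewrite nthc.
split=> [fM k Mk|inj].
  have /freeP fT : free (Tuple szc) by [].
  by apply/matrixP => j b; rewrite ord1 mxE (fT (fun j => k j 0)) // sumE.
suff : free (Tuple szc) by [].
apply/freeP => k k0 j.
have /inj/matrixP/(_ j 0) : M *m (\col_j k j) = 0.
  by rewrite -sumE -[RHS]k0; apply: eq_bigr => l _; rewrite mxE.
by rewrite !mxE.
Qed.

Lemma sqnorm_eq0 n (v : 'cV[R]_n) : v^T *m v = 0 -> v = 0.
Proof.
move=> v0; apply/matrixP => a b; rewrite ord1 mxE; apply/eqP.
have := congr1 (fun A : 'M[R]_1 => A 0 0) v0; rewrite !mxE => /eqP.
rewrite psumr_eq0; last by move=> j _; rewrite mxE -expr2 sqr_ge0.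
by move=> /allP/(_ a (mem_index_enum a)); rewrite mxE -expr2 sqrf_eq0.
Qed.

(** The Gram determinant turns independence into an open polynomial condition and provides the
    inverse used in the projector. *)
Lemma frames_gram M : frames M <-> \det (M^T *m M) != 0.
Proof.
rewrite -unitfE -unitmxE framesP; split=> [inj|uG k Mk].
  rewrite -row_free_unit -kermx_eq0; apply/eqP/row_matrixP => a.
  rewrite row0; set r := row a _.
  have rG : r *m (M^T *m M) = 0 by rewrite /r -row_mul mulmx_ker row0.
  have : M *m r^T = 0.
    apply: sqnorm_eq0; rewrite trmx_mul trmxK -mulmxA [M^T *m _]mulmxA.
    by rewrite mulmxA rG mul0mx.
  by move=> /inj /(congr1 trmx); rewrite trmxK trmx0.
have : M^T *m M *m k = 0 by rewrite -mulmxA Mk mulmx0.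
by move=> /(congr1 (mulmx (invmx (M^T *m M)))); rewrite mulKmx // mulmx0.
Qed.

Lemma frames_mulr M (g : 'M[R]_i) : frames M -> g \in unitmx -> frames (M *m g).
Proof.
move=> /framesP inj ug; apply/framesP => k; rewrite -mulmxA => /inj gk.
by rewrite -(mulKmx ug k) gk mulmx0.
Qed.

Lemma frames_mull M (A : 'M[R]_d) : frames M -> A \in unitmx -> frames (A *m M).
Proof.
move=> /framesP inj uA; apply/framesP => k; rewrite -mulmxA => Ak.
by apply: inj; rewrite -(mulKmx uA (M *m k)) Ak mulmx0.
Qed.

Lemma open_frames : open (frames : set 'M[R]_(d, i)).
Proof.
have -> : (frames : set 'M[R]_(d, i)) = (fun M => \det (M^T *m M)) @^-1` [set x
  : R | x != 0].
  by apply/seteqP; split=> M /frames_gram.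
apply: open_comp; last exact: open_neq.
move=> M _; apply: continuous_det; apply: continuous_mulmx.
  by apply: continuous_trmx => ?; exact: cvg_id.
by move=> ?; exact: cvg_id.
Qed.

Variable E0 : Grass R i d.

(* [E0] is a junk value, taken outside [frames]. *)
Definition span_of M : Grass R i d :=
  if pselect (frames M) is left fM then plane_of_frame (exist _ M (mem_set fM))
  else E0.

Lemma span_of_val (M : frames : set 'M[R]_(d, i)) :
  span_of (set_val M) = plane_of_frame M.
Proof.
rewrite /span_of; case: pselect => [fM|]; last by have := set_valP M.
congr plane_of_frame; exact: val_inj.
Qed.

Lemma plane_span_of M : frames M -> plane (span_of M) = <<cols M>>%VS.
Proof. by move=> fM; rewrite /span_of; case: pselect. Qed.

Lemma mem_span_of M v : frames M ->
  v \in plane (span_of M) <-> exists k : 'cV[R]_i, v = M *m k.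
Proof. by move=> fM; rewrite plane_span_of // mem_cols. Qed.

Lemma Grass_eq (E F : Grass R i d) : plane E = plane F -> E = F.
Proof. by move=> EF; exact: val_inj. Qed.

Lemma span_of_surj E : exists2 M, frames M & span_of M = E.
Proof.
have dimE : \dim (plane E) = i by apply/eqP; case: E.
pose M : 'M[R]_(d, i) := \matrix_(a, j) (vbasis (plane E))`_j a 0.
have colsE : cols M = vbasis (plane E).
  apply: (@eq_from_nth _ 0);
    first by rewrite size_map size_enum_ord size_tuple dimE.
  move=> j; rewrite size_map size_enum_ord => ji.
  rewrite (nth_map (Ordinal ji)) ?size_enum_ord // (nth_ord_enum _ (Ordinal
    ji)).
  by apply/matrixP => a b; rewrite !mxE ord1.
have fM : frames M.
  by rewrite /frames /= -/(cols M) colsE; exact: basis_free (vbasisP _).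
exists M => //; apply: Grass_eq; rewrite plane_span_of // colsE.
exact: span_basis (vbasisP _).
Qed.

Lemma span_of_sub M M' : frames M -> frames M' ->
  (plane (span_of M') <= plane (span_of M))%VS ->
  exists2 g : 'M[R]_i, g \in unitmx & M' = M *m g.
Proof.
move=> fM fM' sub.
have /choice[k kP] (j : 'I_i) : exists k : 'cV[R]_i, col j M' = M *m k.
  apply/(mem_span_of _ fM); apply: (subvP sub); apply/(mem_span_of _ fM').
  by exists (delta_mx j 0); rewrite colE.
pose g : 'M[R]_i := \matrix_(a, j) k j a 0.
have M'E : M' = M *m g.
  apply/matrixP => a j; have /matrixP/(_ a 0) := kP j; rewrite !mxE => ->.
  by apply: eq_bigr => l _; rewrite mxE.
exists g => //; have /framesP inj := fM'.
rewrite -unitmx_tr -row_free_unit -kermx_eq0; apply/eqP/row_matrixP => a.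
rewrite row0; set r := row a _.
have rG : r *m g^T = 0 by rewrite /r -row_mul mulmx_ker row0.
have : M' *m r^T = 0.
  by rewrite M'E -mulmxA -[g]trmxK -trmx_mul rG trmx0 mulmx0.
by move=> /inj /(congr1 trmx); rewrite trmxK trmx0.
Qed.

Lemma span_of_eq M M' : frames M -> frames M' -> span_of M = span_of M' ->
  exists2 g : 'M[R]_i, g \in unitmx & M' = M *m g.
Proof. by move=> fM fM' eq; apply: span_of_sub => //; rewrite eq. Qed.

Lemma span_of_mulr M (g : 'M[R]_i) : frames M -> g \in unitmx ->
  span_of (M *m g) = span_of M.
Proof.
move=> fM ug; have fMg := frames_mulr fM ug.
apply/Grass_eq/vspaceP => v; apply/idP/idP.
  move=> /(mem_span_of _ fMg)[k ->]; apply/(mem_span_of _ fM).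
  by exists (g *m k); rewrite mulmxA.
move=> /(mem_span_of _ fM)[k ->]; apply/(mem_span_of _ fMg).
by exists (invmx g *m k); rewrite -mulmxA mulKVmx.
Qed.

Lemma plane_span_mull (A : 'M[R]_d) M : frames M -> A \in unitmx ->
  plane (span_of (A *m M)) = act A (plane (span_of M)).
Proof.
move=> fM uA; apply/vspaceP => v; apply/idP/idP.
  move=> /(mem_span_of _ (frames_mull fM uA))[k ->]; rewrite -mulmxA.
  rewrite /act -[A *m _](lfunE (mulmx A)); apply: memv_img.
  by apply/(mem_span_of _ fM); exists k.
move=> /memv_imgP[w /(mem_span_of _ fM)[k ->] ->]; rewrite lfunE /=.
by apply/(mem_span_of _ (frames_mull fM uA)); exists k; rewrite mulmxA.
Qed.

Lemma open_span_of_preimage (U : set (Grass R i d)) : open U ->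
  open [set M : 'M[R]_(d, i) | frames M /\ U (span_of M)].
Proof.
move=> oU; have [W oW WE] : open (plane_of_frame @^-1` U) := oU.
have -> : [set M : 'M[R]_(d, i) | frames M /\ U (span_of M)] = (frames : set
  'M[R]_(d, i)) `&` W.
  apply/seteqP; split=> M [fM].
    move=> UM; split=> //; pose M' : frames := exist _ M (mem_set fM).
    have : (plane_of_frame @^-1` U) M' by rewrite /preimage /= -span_of_val.
    by rewrite -WE.
  move=> WM; split=> //; pose M' : frames := exist _ M (mem_set fM).
  have : (set_val @^-1` W) M' by [].
  by rewrite WE /preimage /= -span_of_val.
by apply: openI => //; exact: open_frames.
Qed.

(** The quotient map is open: the saturation of [W] is a union of preimages of [W] under right
    multiplication by invertible matrices. *)
Lemma open_span_of_image (W : set 'M[R]_(d, i)) : open W ->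
  W `<=` (frames : set 'M[R]_(d, i)) -> open (span_of @` W).
Proof.
move=> oW Wf.
pose V := \bigcup_(g in [set g : 'M[R]_i | g \in unitmx]) ((mulmx^~ g) @^-1` W).
have oV : open V.
  apply: bigcup_open => g _; apply: open_comp => // M _.
  by apply: continuous_mulmx; [move=> ?; exact: cvg_id | exact: cst_continuous].
exists V => //; apply/seteqP; split=> M.
  move=> [g ug WMg]; exists (set_val M *m g) => //.
  by rewrite span_of_mulr ?span_of_val //; exact: set_valP.
move=> [M' WM' eq]; rewrite -span_of_val in eq.
have fM : frames (set_val M) by exact: set_valP.
have [g ug M'E] := span_of_eq fM (Wf _ WM') (esym eq).
by exists g => //; rewrite /preimage /= -M'E.
Qed.

Lemma span_of_continuous (B : set 'M[R]_(d, i)) : B `<=` (frames : set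
  'M[R]_(d, i)) ->
  {within B, continuous span_of}.
Proof.
move=> Bf; apply: (continuous_subspaceW Bf); apply: continuous_in_subspaceT.
apply/(continuous_inP _ open_frames) => U oU.
exact: open_span_of_preimage.
Qed.

(* The orthogonal projector onto the column space, which separates planes;
   written with the adjugate so that its continuity is visible. *)
Definition proj_mx_of M : 'M[R]_d :=
  (\det (M^T *m M))^-1 *: (M *m \adj (M^T *m M) *m M^T).

Lemma proj_mx_ofE M : frames M -> proj_mx_of M = M *m invmx (M^T *m M) *m M^T.
Proof.
move=> /frames_gram; rewrite -unitfE -unitmxE => uG.
by rewrite /proj_mx_of /invmx uG -scalemxAr -scalemxAl.
Qed.

Lemma proj_mx_ofK M : frames M -> proj_mx_of M *m M = M.
Proof.
move=> fM; have /frames_gram := fM; rewrite -unitfE -unitmxE => uG.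
by rewrite proj_mx_ofE // -mulmxA mulmxKV.
Qed.

Lemma proj_mx_of_mulr M (g : 'M[R]_i) : frames M -> g \in unitmx ->
  proj_mx_of (M *m g) = proj_mx_of M.
Proof.
move=> fM ug; rewrite !proj_mx_ofE //; last exact: frames_mulr.
have /frames_gram := fM; rewrite -unitfE -unitmxE => uG.
have -> : (M *m g)^T *m (M *m g) = g^T *m (M^T *m M) *m g.
  by rewrite trmx_mul !mulmxA.
set G := M^T *m M in uG *.
pose H := g^T *m G *m g; pose Z := g *m invmx H *m g^T.
have uH : H \in unitmx by rewrite !unitmx_mul unitmx_tr ug uG.
have ZGg : Z *m G *m g = g.
  have HE : g^T *m (G *m g) = H by rewrite mulmxA.
  clearbody G; by rewrite /Z -!mulmxA HE mulVmx // mulmx1.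
have ZE : Z = invmx G.
  have ZG : Z *m G = 1%:M by rewrite -(mulmxK ug (Z *m _)) ZGg mulmxV.
  by rewrite -(mulmxK uG Z) ZG mul1mx.
by rewrite trmx_mul -ZE /Z /H !mulmxA.
Qed.

Lemma proj_mx_of_inj M M' : frames M -> frames M' ->
  proj_mx_of M = proj_mx_of M' -> span_of M = span_of M'.
Proof.
move=> fM fM' eq; apply/Grass_eq/vspaceP => v; apply/idP/idP.
  move=> /(mem_span_of _ fM)[k ->]; apply/(mem_span_of _ fM').
  rewrite -(proj_mx_ofK fM) eq proj_mx_ofE // -!mulmxA.
  by eexists.
move=> /(mem_span_of _ fM')[k ->]; apply/(mem_span_of _ fM).
rewrite -(proj_mx_ofK fM') -eq proj_mx_ofE // -!mulmxA.
by eexists.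
Qed.

Lemma proj_mx_of_continuous :
  {in (frames : set 'M[R]_(d, i)), continuous proj_mx_of}.
Proof.
move=> M /set_mem /frames_gram dM; rewrite /proj_mx_of.
have cid : continuous (fun M : 'M[R]_(d, i) => M) by move=> ?; exact: cvg_id.
have cG : continuous (fun M : 'M[R]_(d, i) => M^T *m M).
  by apply: continuous_mulmx => //; exact: continuous_trmx.
have cdet : continuous (fun M : 'M[R]_(d, i) => \det (M^T *m M)) by exact:
  continuous_det.
have cA : continuous (fun M : 'M[R]_(d, i) => M *m \adj (M^T *m M) *m M^T).
  apply: continuous_mulmx; last exact: continuous_trmx.
  apply: continuous_mulmx => //; apply: continuous_mx => a b x.
  under eq_fun do rewrite mxE.
  have hd : continuous (fun x : 'M[R]_(d, i) =>
      \det (row' b (col' a (x^T *m x)))).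
    apply: continuous_det; apply: continuous_mx => u v.
    have -> : (fun x : 'M[R]_(d, i) => row' b (col' a (x^T *m x)) u v) =
        fun x => (x^T *m x) (lift b u) (lift a v).
      by apply/funext => y; rewrite mxE mxE.
    exact: continuous_coord.
  rewrite /cofactor.
  have h := @cvgM R 'M[R]_(d, i) (nbhs x) _ (cst ((-1) ^+ (b + a))) _ _ _
    (cvg_cst _) (hd x).
  exact: h.
apply: (@cvg_mx R _ _ _ (nbhs M) (nbhs_filter M)) => a b.
have -> : (fun N : 'M[R]_(d, i) =>
    ((\det (N^T *m N))^-1 *: (N *m \adj (N^T *m N) *m N^T)) a b) =
    fun N => (\det (N^T *m N))^-1 * (N *m \adj (N^T *m N) *m N^T) a b.
  by apply/funext => N; rewrite mxE.
rewrite mxE.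
have h := @cvgM R 'M[R]_(d, i) (nbhs M) _ _ _ _ _ (cvgV dM (cdet M))
  (@continuous_coord R _ _ _ _ a b cA M).
exact: h.
Qed.

(** Disjoint neighbourhoods of the two projectors are pulled back to frames and pushed down by the
    open quotient map; they stay disjoint because the projector depends only on the plane. *)
Lemma Grass_hausdorff : hausdorff_space (Grass R i d).
Proof.
rewrite open_hausdorff => E F EF.
have [M fM ME] := span_of_surj E; have [M' fM' ME'] := span_of_surj F.
have PP : proj_mx_of M != proj_mx_of M'.
  apply: contra EF => /eqP eq; rewrite -ME -ME'; apply/eqP.
  exact: proj_mx_of_inj.
have := @norm_hausdorff R 'M[R]_d; rewrite open_hausdorff => /(_ _ _ PP).
move=> [[A B] /= [MA MB] [oA oB AB]].
have contP := (continuous_inP proj_mx_of open_frames).1 proj_mx_of_continuous.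
exists (span_of @` (frames `&` proj_mx_of @^-1` A),
        span_of @` (frames `&` proj_mx_of @^-1` B)).
  split; apply/mem_set.
    by exists M => //; split=> //; exact: set_mem.
  by exists M' => //; split=> //; exact: set_mem.
split=> /=.
- by apply: open_span_of_image; [exact: contP | move=> ? []].
- by apply: open_span_of_image; [exact: contP | move=> ? []].
- apply/eqP/seteqP; split=> // H [[N [fN NA] <-] [N' [fN' NB] eq]].
  have [g ug NE] := span_of_eq fN fN' (esym eq).
  move: AB => /eqP/seteqP[+ _] => /(_ (proj_mx_of N)); apply; split=> //.
  by have := NB; rewrite /preimage /= NE proj_mx_of_mulr.
Qed.

(** A compact set of frames representing every plane, through which compactness arguments on the
    Grassmannian are run. *)
Definition orthonormal_mx : set 'M[R]_(d, i) := [set M | M^T *m M = 1%:M].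

Lemma orthonormal_mx_frames : orthonormal_mx `<=` frames.
Proof.
move=> M; rewrite /orthonormal_mx /= => MM; apply/frames_gram.
by rewrite MM det1 oner_neq0.
Qed.

Lemma orthonormal_mx_compact : compact orthonormal_mx.
Proof.
apply: (@mx_bounded_closed_compact _ _ _ _ 1).
  move=> M /(congr1 (fun A : 'M[R]_i => A _ _)) MM a b.
  have := MM b b; rewrite !mxE eqxx mulr1n => eq1.
  rewrite -(ler_pXn2r (ltn0Sn 1)) ?nnegrE // real_normK ?num_real // expr1n
    -eq1.
  rewrite (bigD1 a) //= mxE -expr2 lerDl sumr_ge0 // => j _.
  by rewrite mxE -expr2 sqr_ge0.
have -> : orthonormal_mx = (fun M => M^T *m M) @^-1` [set 1%:M] by [].
apply: preimage_closed.
  move=> M _; apply: continuous_mulmx; last by move=> ?; exact: cvg_id.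
  by apply: continuous_trmx => ?; exact: cvg_id.
apply: accessible_closed_set1; apply: hausdorff_accessible.
exact: norm_hausdorff.
Qed.

(** Multiplying by the inverse square root of the Gram matrix orthonormalises the columns without
    changing their span. *)
Lemma span_of_orthonormal E : exists2 M, orthonormal_mx M & span_of M = E.
Proof.
have [M fM <-] := span_of_surj E.
have [[symS _] SS] := psd_sqrtP M; set S := psd_sqrt _ in symS SS.
have uG : M^T *m M \in unitmx by rewrite unitmxE unitfE; apply/frames_gram.
have uS : S \in unitmx by move: uG; rewrite -SS unitmx_mul => /andP[].
exists (M *m invmx S); last by rewrite span_of_mulr // unitmx_inv.
rewrite /orthonormal_mx /= trmx_mul trmx_inv symS mulmxA -(mulmxA _ M^T) -SS.
by rewrite mulmxA mulVmx // mul1mx mulmxV.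
Qed.

Lemma span_of_compact (B : set 'M[R]_(d, i)) : compact B -> B `<=` frames ->
  compact (span_of @` B).
Proof. by move=> cB Bf; apply: continuous_compact => //;
  exact: span_of_continuous. Qed.

Lemma span_of_orthonormal_preimage (K : set (Grass R i d)) : closed K ->
  exists B : set 'M[R]_(d, i), [/\ compact B, B `<=` orthonormal_mx &
    span_of @` B = K].
Proof.
move=> clK; exists (orthonormal_mx `&` [set M | K (span_of M)]); split.
- have -> : orthonormal_mx `&` [set M | K (span_of M)] =
    orthonormal_mx `&` ~` [set M | frames M /\ (~` K) (span_of M)].
    apply/seteqP; split=> M [oM] KM; split=> //.
      by move=> [_]; apply.
    apply: contrapT => nK; apply: KM; split=> //.
    exact: orthonormal_mx_frames.
  apply: compact_closedI; first exact: orthonormal_mx_compact.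
  by apply: open_closedC; apply: open_span_of_preimage; exact: closed_openC.
- by move=> M [].
- apply/seteqP; split=> [_ [M [_ KM] <-]|E KE] //.
  by have [M oM ME] := span_of_orthonormal E; exists M => //; split=> //=;
    rewrite ME.
Qed.

Lemma closed_ball_mx_connected m n (M : 'M[R]_(m, n)) (r : R) : 0 <= r ->
  connected [set N : 'M[R]_(m, n) | `|M - N| <= r].
Proof.
move=> r0.
have -> : [set N : 'M[R]_(m, n) | `|M - N| <= r] =
   \bigcup_(N in [set N : 'M[R]_(m, n) | `|M - N| <= r])
     ((fun t : R => M + t *: (N - M)) @` `[0, 1]).
  apply/seteqP; split=> [N MN|z [N /= MN [t]]].
    exists N => //; exists 1; first by rewrite /= in_itv /= ler01 lexx.
    by rewrite scale1r addrC subrK.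
  rewrite /= in_itv /= => /andP[t0 t1] <- /=.
  rewrite opprD addrA subrr sub0r normrN normrZ ger0_norm // distrC.
  by apply: le_trans MN; rewrite ler_piMl.
apply: bigcup_connected.
  exists M => N _; exists 0; first by rewrite /= in_itv /= lexx ler01.
  by rewrite scale0r addr0.
move=> N _; apply: connected_continuous_connected;
  first exact: segment_connected.
apply: continuous_subspaceT => t; apply: cvgD; first exact: cvg_cst.
by apply: cvgZr_tmp; exact: cvg_id.
Qed.

(** The image of a small closed ball of frames is connected and compact, hence closed by the
    Hausdorff property; it is a neighbourhood because the quotient map is open. *)
Lemma Grass_local_base (U : set (Grass R i d)) M : open U -> frames M ->
  U (span_of M) -> exists (W : set 'M[R]_(d, i)) (B : set (Grass R i d)),
    [/\ open W, W M, span_of @` W `<=` B°, closed B /\ connected B & B `<=` U].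
Proof.
move=> oU fM UM.
have : nbhs M [set M | frames M /\ U (span_of M)].
  by apply: open_nbhs_nbhs; split=> //; exact: open_span_of_preimage.
move=> /nbhs_ballP[e /= e0 eU].
pose Bc := [set N : 'M[R]_(d, i) | `|M - N| <= e / 2].
have e20 : 0 < e / 2 by rewrite divr_gt0.
have BcU : Bc `<=` [set M | frames M /\ U (span_of M)].
  move=> N MN; apply: eU; rewrite -ball_normE /ball_ /=.
  by apply: le_lt_trans MN _; rewrite ltr_pdivrMr // ltr_pMr // ltr1n.
have Bcf : Bc `<=` frames by move=> N /BcU[].
exists (ball M (e / 2)), (span_of @` Bc).
have sub : ball M (e / 2) `<=` Bc.
  by move=> N; rewrite -ball_normE /ball_ /= => /ltW.
split.
- exact: ball_open.
- exact: ballxx.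
- rewrite -open_subsetE; last first.
    by apply: open_span_of_image;
      [exact: ball_open | apply: subset_trans sub Bcf].
  exact: image_subset.
- split.
    apply: compact_closed; first exact: Grass_hausdorff.
    apply: span_of_compact => //;
      apply: (@mx_bounded_closed_compact _ _ _ _ (`|M| + e / 2)).
      move=> N /= MN a b; apply: (@le_trans _ _ `|N|).
        rewrite [leRHS]/Num.Def.normr /= mx_normrE.
        by apply/bigmax_geP; right; exists (a, b).
      by rewrite -lerBlDl; apply: le_trans MN; rewrite distrC lerB_dist.
    have -> : Bc = closed_ball M (e / 2) by rewrite closed_ballE.
    exact: closed_ball_closed.
  apply: connected_continuous_connected; last exact: span_of_continuous.
  exact/closed_ball_mx_connected/ltW.
- by move=> _ [N /BcU[_ UN] <-].
Qed.

Lemma Grass_finite_components (K U : set (Grass R i d)) : closed K -> open U ->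
  K `<=` U -> exists C : set (Grass R i d), [/\ K `<=` C°, C `<=` U
    & finitely_many_separated_components C].
Proof.
move=> clK oU KU; have [B [cB Bo BK]] := span_of_orthonormal_preimage clK.
have [|C [BC CU _ fC]] := @finite_components_cover _ _ span_of B U cB.
  move=> M BM; apply: Grass_local_base => //.
    exact/orthonormal_mx_frames/Bo.
  by apply: KU; rewrite -BK; exists M.
by exists C; rewrite -BK.
Qed.

End Frames.

(** * The multicone *)

Section CompactBounds.
Context {R : realType}.

Lemma compact_upper_bound (T : topologicalType) (A : set T) (f : T -> R) :
  compact A -> continuous f -> exists K, forall x, A x -> f x <= K.
Proof.
move=> cA cf; have [A0|/set0P/negP/negPn/eqP A0] := pselect (A !=set0);
  last first.
  by exists 0 => x; rewrite A0.
have [c _ fc] := compact_EVT_max A0 cA (continuous_subspaceT cf).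
by exists (f c) => x Ax; apply: fc; rewrite inE.
Qed.

Lemma compact_pos_lower_bound (T : topologicalType) (A : set T) (f : T -> R) :
  compact A -> continuous f -> (forall x, A x -> 0 < f x) ->
  exists2 c, 0 < c & forall x, A x -> c <= f x.
Proof.
move=> cA cf f0; have [A0|/set0P/negP/negPn/eqP A0] := pselect (A !=set0);
  last first.
  by exists 1 => // x; rewrite A0.
have [c cA' fc] := compact_EVT_min A0 cA (continuous_subspaceT cf).
by exists (f c) => [|x Ax]; [apply/f0/set_mem | apply: fc; rewrite inE].
Qed.

Lemma continuous_sumr (T : topologicalType) (I : finType) (f : I -> T -> R) :
  (forall i, continuous (f i)) -> continuous (fun x => \sum_i f i x).
Proof.
move=> cf x.
have h := @cvg_sum R T I (index_enum I) xpredT (nbhs x) (nbhs_filter x) f _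
  (fun i => cf i x).
exact: h.
Qed.

Lemma continuous_l1norm (T : topologicalType) m n (f : T -> 'M[R]_(m, n)) :
  continuous f -> continuous (fun x => l1norm (f x)).
Proof.
move=> cf; apply: continuous_sumr => a; apply: continuous_sumr => b x.
have h := @cvg_norm _ R _ (nbhs x) (nbhs_filter x) _ _ (@continuous_coord R T _
  _ f a b cf x).
exact: h.
Qed.

Lemma continuous_compound (T : topologicalType) i m n (f : T -> 'M[R]_(m, n)) :
  continuous f -> continuous (fun x => compound i (f x)).
Proof.
move=> cf; apply: continuous_mx => a b.
have -> : (fun x => compound i (f x) a b) =
    (fun x => i`!%:R^-1 * \det (mxsub (multi a) (multi b) (f x))).
  by apply/funext => x; rewrite mxE.
have cd : continuous (fun x => \det (mxsub (multi a) (multi b) (f x))).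
  apply: continuous_det; apply: continuous_mx => u v.
  have -> : (fun x => mxsub (multi a) (multi b) (f x) u v) =
    fun x => f x (multi a u) (multi b v) by apply/funext => x; rewrite mxE.
  exact: continuous_coord.
move=> x; have h := @cvgM R T (nbhs x) _ (cst (i`!%:R^-1)) _ _ _ (cvg_cst _)
  (cd x).
exact: h.
Qed.

Lemma continuous_plucker (T : topologicalType) i m (f : T -> 'M[R]_(m, i)) :
  continuous f -> continuous (fun x => plucker (f x)).
Proof.
move=> cf; apply: continuous_mx => a b.
have -> : (fun x => plucker (f x) a b) =
    (fun x => \det (rowsub (multi a) (f x))).
  by apply/funext => x; rewrite mxE.
apply: continuous_det; apply: continuous_mx => u v.
have -> : (fun x => rowsub (multi a) (f x) u v) = fun x => f x (multi a u) v.
  by apply/funext => x; rewrite mxE.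
exact: continuous_coord.
Qed.

Lemma compoundZ i m n (c : R) (A : 'M[R]_(m, n)) :
  compound i (c *: A) = c ^+ i *: compound i A.
Proof.
apply/matrixP => a b; rewrite !mxE mulrCA -detZ; congr (_ * \det _).
by apply/matrixP => x y; rewrite !mxE.
Qed.

Lemma compound_bounds i d (Sigma : set 'M[R]_d) :
  compact Sigma -> (forall A, Sigma A -> A \in unitmx) ->
  exists2 K : R, 1 <= K & l1norm (compound i (1%:M : 'M[R]_d)) <= K /\
    forall A, Sigma A ->
    l1norm (compound i A) <= K /\ l1norm (compound i (invmx A)) <= K.
Proof.
move=> cS uS.
have cid : continuous (fun A : 'M[R]_d => A) by move=> ?; exact: cvg_id.
have [K1 hK1] := compact_upper_bound cS
  (continuous_l1norm (@continuous_compound _ i _ _ _ cid)).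
(* The inverse is bounded through the adjugate, which is polynomial, and a positive lower bound of
   the absolute determinant on [Sigma]. *)
have cadj : continuous (fun A : 'M[R]_d => \adj A).
  apply: continuous_mx => a b x; under eq_fun do rewrite mxE.
  have hd : continuous (fun x : 'M[R]_d => \det (row' b (col' a x))).
    apply: continuous_det; apply: continuous_mx => u v.
    have -> : (fun x : 'M[R]_d => row' b (col' a x) u v) =
        fun x => x (lift b u) (lift a v).
      by apply/funext => y; rewrite mxE mxE.
    exact: continuous_coord.
  rewrite /cofactor.
  have h := @cvgM R 'M[R]_d (nbhs x) _ (cst ((-1) ^+ (b + a))) _ _ _
    (cvg_cst _) (hd x).
  exact: h.
have [K2 hK2] := compact_upper_bound cS
  (continuous_l1norm (@continuous_compound _ i _ _ _ cadj)).
have cdet : continuous (fun A : 'M[R]_d => `|\det A|).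
  move=> x; have cd := continuous_det cid.
  have h := @cvg_norm _ R _ (nbhs x) (nbhs_filter x) _ _ (cd x).
  exact: h.
have [c c0 hc] : exists2 c, 0 < c & forall A : 'M[R]_d, Sigma A -> c <= `|\det
  A|.
  apply: compact_pos_lower_bound cS cdet _ => A /uS.
  by rewrite unitmxE unitfE normr_gt0.
exists (1 + l1norm (compound i (1%:M : 'M[R]_d)) + `|K1| + c ^- i * `|K2|).
  by rewrite -!addrA lerDl !addr_ge0 ?l1norm_ge0 // mulr_ge0 ?invr_ge0
    ?exprn_ge0 ?(ltW c0).
set e := c ^- i * _.
have e0 : 0 <= e by rewrite mulr_ge0 ?invr_ge0 ?exprn_ge0 ?(ltW c0).
have n1 := l1norm_ge0 (compound i (1%:M : 'M[R]_d)).
have k1 := normr_ge0 K1.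
split; first by lra.
move=> A SA; split.
  by have := hK1 A SA; have := ler_norm K1; lra.
have -> : invmx A = (\det A)^-1 *: \adj A by rewrite /invmx (uS A SA).
rewrite compoundZ l1normZ normrX normfV.
suff : `|\det A|^-1 ^+ i * l1norm (compound i (\adj A)) <= e by lra.
apply: ler_pM; rewrite ?exprn_ge0 ?invr_ge0 ?l1norm_ge0 //.
  have dA : 0 < `|\det A| by exact: lt_le_trans (hc A SA).
  by rewrite exprVn lef_pV2 ?posrE ?exprn_gt0 // lerXn2r ?nnegrE ?(ltW c0)
    ?(ltW dA) ?hc.
exact: le_trans (hK2 A SA) (ler_norm _).
Qed.

End CompactBounds.

Lemma invmx_mul (F : fieldType) n (A B : 'M[F]_n) : A \in unitmx -> B \in
  unitmx ->
  invmx (A *m B) = invmx B *m invmx A.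
Proof.
move=> uA uB; have uAB : A *m B \in unitmx by rewrite unitmx_mul uA.
have e : invmx B *m invmx A *m (A *m B) = 1%:M by rewrite -mulmxA mulKmx //
  mulVmx.
by rewrite -[RHS](mulmxK uAB) e mul1mx.
Qed.

(** * Growth of the exterior powers of products of letters *)

Section Cone.
Context {R : realType}.
Variables (d i : nat) (Sigma : set 'M[R]_d).
Hypothesis hi : (1 <= i <= d - 1)%N.
Hypothesis hGL : forall A, Sigma A -> A \in unitmx.
Hypothesis hcompact : compact Sigma.
Hypothesis hdom : dominated i Sigma.
Implicit Types (M : 'M[R]_(d, i)) (w : seq Sigma).

Definition word_prod (w : seq Sigma) : 'M[R]_d :=
  foldr (fun A P => set_val A *m P) 1%:M w.

Lemma word_prod_cat u v : word_prod (u ++ v) = word_prod u *m word_prod v.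
Proof. by elim: u => [|a u IH] /=; rewrite ?mul1mx // IH mulmxA. Qed.

Lemma word_prod_unit w : word_prod w \in unitmx.
Proof.
elim: w => [|a w IH] /=; first exact: unitmx1.
by rewrite unitmx_mul IH andbT; apply: hGL; exact: set_valP.
Qed.

Lemma word_prodE (w : seq Sigma) (a0 : Sigma) :
  word_prod w = \prod_(k < size w) set_val (nth a0 w k).
Proof.
elim: w => [|a w IH]; first by rewrite big_ord0.
by rewrite big_ord_recl /= IH.
Qed.

Definition word_norm w := l1norm (compound i (word_prod w)).

Definition plucker_norm (M : 'M[R]_(d, i)) := l1norm (plucker M).

Lemma plucker_norm_mul A M :
  plucker_norm (A *m M) <= l1norm (compound i A) * plucker_norm M.
Proof. by rewrite /plucker_norm plucker_mul l1normM. Qed.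

Lemma plucker_neq0 M : frames M -> plucker M != 0.
Proof.
move=> /frames_gram dM; apply: contra_neq dM => p0.
have := coplucker_plucker M^T M; rewrite p0 mulmx0.
move=> /(congr1 (fun A : 'M[R]_1 => A 0 0)); rewrite !mxE eqxx mulr1n.
by move=> /esym/eqP; rewrite mulf_eq0 (negPf (factr_neq0 i)) => /eqP.
Qed.

Lemma frames_plucker M : plucker M != 0 -> frames M.
Proof.
move=> p0; apply/framesP => k Mk; apply: contra_neq_eq p0 => k0.
apply/matrixP => a b; rewrite !mxE -det_tr; apply/eqP/det0P.
exists k^T; first by rewrite -trmx0 (inj_eq trmx_inj).
rewrite -trmx_mul; have -> : rowsub (multi a) M *m k = rowsub (multi a) (M *m
  k).
  by apply/matrixP => x y; rewrite !mxE; apply: eq_bigr => l _; rewrite mxE.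
by rewrite Mk; apply/matrixP => x y; rewrite !mxE.
Qed.

Lemma plucker_norm_gt0 M : frames M -> 0 < plucker_norm M.
Proof. by move=> fM; rewrite /plucker_norm l1norm_gt0 plucker_neq0. Qed.

Lemma compound_unit_neq0 (A : 'M[R]_d) : A \in unitmx -> compound i A != 0.
Proof.
move=> uA; have id : (i <= d)%N by move: hi => /andP[]; lia.
pose J : 'M[R]_(d, i) := pid_mx i.
have fJ : frames J.
  apply/frames_gram; rewrite /J tr_pid_mx mul_pid_mx minnn (minn_idPr id)
    pid_mx_1.
  by rewrite det1 oner_neq0.
have := plucker_neq0 (frames_mull fJ uA); rewrite plucker_mul;
  apply: contra_neq.
by move=> ->; rewrite mul0mx.
Qed.

Lemma word_norm_gt0 w : 0 < word_norm w.
Proof. by rewrite /word_norm l1norm_gt0 compound_unit_neq0 // word_prod_unit.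
  Qed.

(** [Y] is left general: it is the compound of a further word in the growth estimate and a Pluecker
    column when planes are tracked. *)
Lemma middle_bound (P Q : 'M[R]_d) n
    (Y : 'M[R]_(#|{: {ffun 'I_i -> 'I_d}}|, n)) (eps : R) :
  (exists (x : 'cV[R]_#|{: {ffun 'I_i -> 'I_d}}|) (N : 'M[R]_(i, d)),
    row_free N /\
    l1norm (compound i Q - x *m coplucker N) <= eps * l1norm (compound i Q)) ->
  l1norm (compound i (P *m Q)) * l1norm (compound i Q *m Y) <=
    l1norm (compound i (P *m Q) *m Y) * l1norm (compound i Q) +
    6 * eps * (l1norm (compound i P) * l1norm (compound i Q) ^+ 2 * l1norm Y).
Proof.
move=> [x [N [_ hE]]]; rewrite compoundM.
set E := compound i Q - _ in hE.
have QE : compound i Q = x *m coplucker N + E by rewrite /E addrC subrK.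
clearbody E; rewrite QE in hE *.
exact: l1norm_middle.
Qed.

(** The exponents are [(size w).+1] because the empty word already has the norm of the compound of
    the identity, which need not be 1. *)
Lemma word_growth : exists K C tau delta : R,
  [/\ 1 <= K, 0 <= C, 0 < tau < 1 & 0 < delta <= 1] /\
  [/\ forall w, word_norm w <= K ^+ (size w).+1,
      forall w, l1norm (compound i (invmx (word_prod w))) <= K ^+ (size w).+1,
      forall u v, delta * (word_norm u * word_norm v) <= word_norm (u ++ v) &
      forall w, (0 < size w)%N ->
        exists (x : 'cV[R]_#|{: {ffun 'I_i -> 'I_d}}|) (N : 'M[R]_(i, d)),
        row_free N /\ l1norm (compound i (word_prod w) - x *m coplucker N) <=
          C * tau ^+ size w * word_norm w].
Proof.
have [K K1 [Knil Kb]] := compound_bounds i hcompact hGL.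
have K0 : 0 < K by exact: lt_le_trans K1.
have [K' K'0 approx] := @compound_rank1_approx R i d hi.
have [C0 [tau [C00 tau01 dom]]] := hdom.
pose C := K' * C0.
have Cge0 : 0 <= C by rewrite mulr_ge0 // ltW.
have happ w : (0 < size w)%N ->
    exists (x : 'cV[R]_#|{: {ffun 'I_i -> 'I_d}}|) (N : 'M[R]_(i, d)),
    row_free N /\ l1norm (compound i (word_prod w) - x *m coplucker N) <=
      C * tau ^+ size w * word_norm w.
  move=> w0; have [x [N [rN le]]] := approx _ (word_prod_unit w).
  exists x, N; split=> //; apply: le_trans le _.
  rewrite ler_wpM2r ?l1norm_ge0 // -mulrA ler_wpM2l ?(ltW K'0) // ltW //.
  case: w w0 => [//|a w] _; rewrite (word_prodE _ a).
  by apply: dom => // k; exact: set_valP.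
have ncat u v : word_norm (u ++ v) <= word_norm u * word_norm v.
  by rewrite /word_norm word_prod_cat compoundM l1normM.
have nlet a : word_norm [:: a] <= K.
  by rewrite /word_norm /= mulmx1; apply: (Kb _ (set_valP a)).1.
have nrcons u a : word_norm u <= K * word_norm (rcons u a).
  rewrite /word_norm -cats1 word_prod_cat /= mulmx1 mulrC.
  rewrite -[in leLHS](mulmxK (hGL (set_valP a)) (word_prod u)) compoundM.
  apply: le_trans (l1normM _ _) _; rewrite ler_wpM2l ?l1norm_ge0 //.
  exact: (Kb _ (set_valP a)).2.
have ncons a u : word_norm u <= K * word_norm (a :: u).
  rewrite /word_norm /= -[in leLHS](mulKmx (hGL (set_valP a)) (word_prod u))
    compoundM.
  apply: le_trans (l1normM _ _) _; rewrite ler_wpM2r ?l1norm_ge0 //.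
  exact: (Kb _ (set_valP a)).2.
have mid u v w : (0 < size v)%N ->
    word_norm (u ++ v) * word_norm (v ++ w) <=
    word_norm (u ++ v ++ w) * word_norm v +
    (6 * C) * tau ^+ size v * (word_norm u * word_norm v ^+ 2 * word_norm w).
  move=> v0; have := middle_bound 
    (word_prod u) (compound i (word_prod w)) (happ v v0).
  rewrite -!compoundM -!word_prod_cat -catA mulrA; exact.
have C6 : 0 <= 6 * C by rewrite mulr_ge0.
have [delta d0 dP] := N_supermult word_norm_gt0 ncat Knil nlet nrcons ncons K1
  C6 tau01 mid.
(* Capping at 1 keeps the cone thresholds in the unit interval, as [cone_perturb] requires. *)
exists K, C, tau, (Num.min delta 1); split.
  by split=> //; rewrite lt_min d0 ltr01 ge_min lexx orbT.
split=> //.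
- by move=> w; exact: (N_le_pow word_norm_gt0 ncat Knil nlet).
- elim=> [|a w IH] /=; first by rewrite invmx1 expr1.
  rewrite (invmx_mul (hGL (set_valP a)) (word_prod_unit w)).
  rewrite compoundM; apply: le_trans (l1normM _ _) _.
  rewrite exprS mulrC ler_pM ?l1norm_ge0 //; exact: (Kb _ (set_valP a)).2.
- move=> u v; apply: le_trans (dP u v).
  by rewrite ler_wpM2r ?mulr_ge0 ?(ltW (word_norm_gt0 _)) // ge_min lexx.
Qed.

End Cone.

Section Kernel.
Context {R : realType}.

Lemma kernel_plane d i (N : 'M[R]_(i, d)) : row_free N ->
  exists F : Grass R (d - i) d, forall v, v \in plane F -> N *m v = 0.
Proof.
move=> /row_freeP[B NB].
pose f : 'Hom('cV[R]_d, 'cV[R]_i) := linfun (mulmx N).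
have dimk : \dim (lker f) == (d - i)%N.
  have := limg_ker_dim f fullv; rewrite capfv.
  have -> : limg f = fullv.
    apply/eqP; rewrite eqEsubv subvf; apply/subvP => v _.
    apply/memv_imgP; exists (B *m v); first exact: memvf.
    by rewrite lfunE /= mulmxA NB mul1mx.
  by rewrite !dimvf /dim /= !muln1 => h; apply/eqP; lia.
exists (exist _ (lker f) dimk) => v; rewrite /plane /= memv_ker lfunE /=.
by move=> /eqP.
Qed.

Lemma kernel_transverse d i (N : 'M[R]_(i, d)) (F : Grass R (d - i) d)
    (E0 : Grass R i d) (M : 'M[R]_(d, i)) : frames M ->
  (forall v, v \in plane F -> N *m v = 0) -> \det (N *m M) != 0 ->
  transverse (span_of E0 M) F.
Proof.
move=> fM FN dNM; rewrite /transverse; apply/eqP; rewrite -subv0.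
apply/subvP => v; rewrite memv_cap => /andP[/(mem_span_of _ _ fM)[k ->] /FN].
rewrite mulmxA => NMk; rewrite memv0.
have uNM : N *m M \in unitmx by rewrite unitmxE unitfE.
by rewrite -(mulKmx uNM k) NMk mulmx0 mulmx0.
Qed.

End Kernel.

(** * The strictly invariant set of planes and its transverse complement *)

Section ConeConstruction.
Context {R : realType}.
Variables (d i : nat) (Sigma : set 'M[R]_d) (K C tau delta : R).
Hypothesis hi : (1 <= i <= d - 1)%N.
Hypothesis hGL : forall A, Sigma A -> A \in unitmx.
Implicit Types (M : 'M[R]_(d, i)) (w P Q : seq Sigma).
Local Notation wp := (@word_prod R d Sigma).
Local Notation N := (@word_norm R d i Sigma).
Local Notation p := (@plucker_norm R d i).
Hypothesis K_ge1 : 1 <= K.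
Hypothesis C_ge0 : 0 <= C.
Hypothesis tau01 : 0 < tau < 1.
Hypothesis delta01 : 0 < delta <= 1.
Hypothesis N_le : forall w, N w <= K ^+ (size w).+1.
Hypothesis N_inv_le : forall w,
  l1norm (compound i (invmx (wp w))) <= K ^+ (size w).+1.
Hypothesis N_super : forall u v, delta * (N u * N v) <= N (u ++ v).
Hypothesis N_approx : forall w, (0 < size w)%N ->
  exists (x : 'cV[R]_#|{: {ffun 'I_i -> 'I_d}}|) (L : 'M[R]_(i, d)),
  row_free L /\ l1norm (compound i (wp w) - x *m coplucker L) <=
    C * tau ^+ size w * N w.

Let N_gt0 w : 0 < N w.
Proof. exact: (word_norm_gt0 hi hGL). Qed.
Let d0 : 0 < delta. Proof. by case/andP: delta01. Qed.
Let d1 : delta <= 1. Proof. by case/andP: delta01. Qed.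
Let tau0 : 0 < tau. Proof. by case/andP: tau01. Qed.
Let K_gt0 : 0 < K. Proof. exact: lt_le_trans K_ge1. Qed.

Definition cone (c : R) M :=
  forall w, c * (N w * p M) <= p (wp w *m M).

Lemma cone_mulr c M (g : 'M[R]_i) : cone c M -> cone c (M *m g).
Proof.
move=> cM w; rewrite /plucker_norm mulmxA !plucker_mulr !l1normZ.
rewrite (_ : c * _ = `|\det g| * (c * (N w * l1norm (plucker M))));
  last by ring.
by rewrite ler_wpM2l.
Qed.

Lemma cone_le c c' M : c' <= c -> cone c M -> cone c' M.
Proof.
move=> cc cM w; apply: le_trans (cM w).
by rewrite ler_wpM2r // mulr_ge0 ?l1norm_ge0.
Qed.

Lemma middle_plucker Q M P : (0 < size Q)%N ->
  N (P ++ Q) * p (wp Q *m M) <= p (wp (P ++ Q) *m M) * N Q +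
    6 * (C * tau ^+ size Q) * (N P * N Q ^+ 2 * p M).
Proof.
move=> Q0; have := middle_bound (wp P) (plucker M) (N_approx Q0).
by rewrite -word_prod_cat -!plucker_mul.
Qed.

(** A lower bound for the single word [Q], however weak, becomes one for all words, with a threshold
    close to [delta] once [Q] is long: in [middle_plucker], [N (P ++ Q)] is at least
    [delta * (N P * N Q)], and measuring the error against the norm of [wp Q *m M] divides it by
    [c]. *)
Lemma cone_contract c Q M : (0 < size Q)%N -> 0 < c ->
  c * (N Q * p M) <= p (wp Q *m M) ->
  cone (delta - 6 * (C * tau ^+ size Q) / c) (wp Q *m M).
Proof.
move=> Q0 c0 QM P.
have := middle_plucker M P Q0; rewrite word_prod_cat -mulmxA => mid.
rewrite -(ler_pM2r (N_gt0 Q)).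
set y := p (wp Q *m M) in QM mid *; set z := p (wp P *m _) in mid *.
have y0 : 0 <= y by exact: l1norm_ge0.
have s1 : delta * (N P * N Q) * y <= N (P ++ Q) * y by rewrite ler_wpM2r.
set e := 6 * (C * tau ^+ size Q) in mid *.
have e0 : 0 <= e by rewrite mulr_ge0 // mulr_ge0 // exprn_ge0 // ltW.
have s2 : e * (N P * N Q ^+ 2 * p M) <= e / c * (N P * N Q * y).
  rewrite (_ : e * _ = e * (N P * N Q) * (N Q * p M)); last by ring.
  rewrite (_ : e / c * _ = e * (N P * N Q) * (c^-1 * y)); last by ring.
  apply: ler_wpM2l; last by rewrite ler_pdivlMl.
  by apply: mulr_ge0 => //; rewrite mulr_ge0 ?(ltW (N_gt0 _)).
rewrite mulrBl mulrBl.
rewrite (_ : delta * _ * _ = delta * (N P * N Q) * y); last by ring.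
rewrite (_ : e / c * _ * _ = e / c * (N P * N Q * y)); last by ring.
by lra.
Qed.

(** Both [p M] and [p (wp w *m M)] vary by at most the Pluecker distance, the latter times [N w]; as
    [c <= 1], this costs [eta] twice. *)
Lemma cone_perturb c eta M M' : 0 <= c <= 1 -> cone c M ->
  l1norm (plucker M - plucker M') <= eta * p M' -> cone (c - 2 * eta) M'.
Proof.
move=> /andP[c0 c1] cM close w.
set D := l1norm _ in close.
have D0 : 0 <= D by exact: l1norm_ge0.
have h1 : p M' <= p M + D.
  have := ler_l1normD (plucker M) (plucker M' - plucker M).
  by rewrite addrC subrK l1normB.
have h2 : p (wp w *m M) <= p (wp w *m M') + N w * D.
  have -> : p (wp w *m M) = l1norm (plucker (wp w *m M') +
      compound i (wp w) *m (plucker M - plucker M')).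
    by rewrite /plucker_norm !plucker_mul mulmxBr addrC subrK.
  apply: le_trans (ler_l1normD _ _) _; rewrite lerD2l; exact: l1normM.
have h3 := cM w.
have N0 := N_gt0 w.
have h4 : c * (N w * p M') <= c * (N w * (p M + D)).
  by rewrite ler_wpM2l // ler_wpM2l // ltW.
have h5 : c * (N w * D) <= N w * D.
  by rewrite ler_piMl // mulr_ge0 // ltW.
have h6 : N w * D <= N w * (eta * p M') by rewrite ler_wpM2l // ltW.
rewrite mulrBl (_ : 2 * eta * _ = 2 * (N w * (eta * p M'))); last by ring.
move: h4; rewrite mulrDr mulrDr; lra.
Qed.

Variable n : nat.
Hypothesis n_gt0 : (0 < n)%N.
Hypothesis n_large : 6 * (C * tau ^+ n) <= (delta / 4) ^+ 2.
Variable E0 : Grass R i d.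
Local Notation sp := (span_of E0).

(* The thresholds decrease with the length of the word, so that each further
   letter leaves room for a perturbation; after [n] letters a plane is back in
   [cone (3 * delta / 4)]. *)
Let c_ k : R := delta / 2 - k%:R * (delta / (4 * n%:R)).

Let nR : 0 < n%:R :> R. Proof. by rewrite ltr0n. Qed.

Let c_S k : c_ k.+1 = c_ k - delta / (4 * n%:R).
Proof. by rewrite /c_ -[k.+1%:R]natr1; ring. Qed.

Let c_ge k : (k <= n)%N -> delta / 4 <= c_ k.
Proof.
move=> kn; rewrite /c_ lerBrDr.
have : k%:R * (delta / (4 * n%:R)) <= n%:R * (delta / (4 * n%:R)).
  by rewrite ler_wpM2r ?ler_nat // divr_ge0 ?mulr_ge0 // ltW.
have -> : n%:R * (delta / (4 * n%:R)) = delta / 4 by field; rewrite gt_eqF.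
by move=> h; have := d0; lra.
Qed.

Let c_le k : c_ k <= delta / 2.
Proof.
by rewrite /c_ gerBl mulr_ge0 // divr_ge0 ?mulr_ge0 // ltW.
Qed.

Definition multicone : set (Grass R i d) :=
  [set E | exists Q M, [/\ (size Q < n)%N, frames M, cone (c_ (size Q)) M &
    sp (wp Q *m M) = E]].

(** [delta / (8 * n%:R)] is half the gap between consecutive thresholds, since a perturbation costs
    [2 * eta]. One factor [K ^+ n.+1] pays for pulling frames back by the inverse of a word, the
    other for comparing the norms of [M'] and of its preimage. *)
Let eta : R := delta / (8 * n%:R) / K ^+ (n.+1 * 2).

Let eta_gt0 : 0 < eta.
Proof. by rewrite /eta divr_gt0 ?exprn_gt0 // divr_gt0 // mulr_gt0. Qed.

Lemma multicone_perturb (a : Sigma) Q M M' : (size Q < n)%N -> frames M ->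
  cone (c_ (size Q)) M -> frames M' ->
  l1norm (plucker (wp (a :: Q) *m M) - plucker M') <= eta * p M' ->
  multicone (sp M').
Proof.
move=> Qn fM cM fM' close.
have K1n k : 1 <= K ^+ k by rewrite exprn_ege1.
have eta8 : eta <= delta / (8 * n%:R).
  rewrite /eta ler_pdivrMr ?exprn_gt0 //; apply: ler_peMr => //.
  by apply: divr_ge0; [exact: ltW | rewrite mulr_ge0 // ltW].
have uaQ : wp (a :: Q) \in unitmx by exact: word_prod_unit.
have [Qn1|Qn1] := ltnP (size Q).+1 n.
  (* While the word stays shorter than [n], the perturbed frame is pulled back, and the drop from
     [c_ (size Q)] to [c_ (size Q).+1] absorbs the perturbation. *)
  pose M3 := invmx (wp (a :: Q)) *m M'.
  have fM3 : frames M3 by apply: frames_mull; rewrite ?unitmx_inv.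
  have M3E : wp (a :: Q) *m M3 = M' by rewrite mulKVmx.
  exists (a :: Q), M3; split=> //; last by rewrite M3E.
  rewrite /= c_S; have -> : delta / (4 * n%:R) = 2 * (delta / (8 * n%:R)).
    by field; rewrite gt_eqF.
  apply: cone_perturb cM _.
    apply/andP; split; first by apply: le_trans (c_ge (ltnW Qn));
      rewrite divr_ge0 // ltW.
    by apply: le_trans (c_le _) _; have := d1; lra.
  have -> : plucker M - plucker M3 = compound i (invmx (wp (a :: Q))) *m
      (plucker (wp (a :: Q) *m M) - plucker M').
    by rewrite mulmxBr -!plucker_mul mulKmx.
  apply: le_trans (l1normM _ _) _.
  apply: (@le_trans _ _ (K ^+ n.+1 * (eta * (K ^+ n.+1 * p M3)))).
    apply: ler_pM; rewrite ?l1norm_ge0 //.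
      by apply: le_trans (N_inv_le _) _; rewrite ler_weXn2l //=; lia.
    apply: le_trans close _; rewrite ler_wpM2l ?(ltW eta_gt0) // -{1}M3E.
    apply: le_trans (plucker_norm_mul _ _) _; rewrite ler_wpM2r ?l1norm_ge0 //.
    by apply: le_trans (N_le _) _; rewrite ler_weXn2l //=; lia.
  rewrite le_eqVlt; apply/orP; left; apply/eqP; rewrite /eta muln2 -addnn exprD.
  by field; rewrite (gt_eqF nR) gt_eqF ?exprn_gt0.
have nE : n = (size Q).+1 by apply/eqP; rewrite eqn_leq Qn1 Qn.
(* At length [n] the word is forgotten: contraction yields the threshold [3 * delta / 4], and losing
   at most [delta / 4] leaves [delta / 2], the threshold of the empty word. *)
exists [::], M'; split=> //; last by rewrite /= mul1mx.
have d4 : 0 < delta / 4 by rewrite divr_gt0.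
have c1 : cone (delta / 4) M by apply: cone_le cM; exact: c_ge (ltnW Qn).
have c2 := @cone_contract (delta / 4) (a :: Q) M isT d4 (c1 _).
have {}c2 : cone (3 * delta / 4) (wp (a :: Q) *m M).
  apply: cone_le c2; rewrite /= -nE.
  have : 6 * (C * tau ^+ n) / (delta / 4) <= delta / 4.
    by rewrite ler_pdivrMr // -expr2.
  by lra.
have {}c3 := cone_perturb _ c2 close.
apply: cone_le (c3 _); last by have := d0; have := d1; move=> ? ?; apply/andP;
  split; lra.
rewrite /c_ mul0r subr0.
have : eta <= delta / 8.
  apply: le_trans eta8 _;
    rewrite ler_wpM2l ?(ltW d0) // lef_pV2 ?posrE ?mulr_gt0 //.
  by rewrite ler_peMr // ler1n.
by lra.
Qed.

Lemma act_inj_frame (A : 'M[R]_d) (E F : Grass R i d) M : A \in unitmx ->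
  frames M -> E = sp M -> plane F = act A (plane E) -> F = sp (A *m M).
Proof.
by move=> uA fM -> eq; apply: Grass_eq; rewrite eq plane_span_mull.
Qed.

Lemma multicone_strictly_invariant : strictly_invariant Sigma multicone.
Proof.
move=> E clE; have [M0 fM0 M0E] := span_of_surj E0 E.
have p0 : 0 < p M0 by exact: plucker_norm_gt0.
(* Two frames [M'] and [M2] within [e * p M0] of [M0] differ by at most [2 * e * p M0]; [e <= 1 / 2]
   turns this into [4 * e * p M2], and [e <= eta / 4] into [eta * p M2]. *)
pose e := Num.min (eta / 4) (1 / 2).
have e0 : 0 < e by rewrite lt_min; apply/andP; split; apply: divr_gt0.
have e4 : 4 * e <= eta.
  have : e <= eta / 4 by rewrite ge_min lexx.
  lra.
have e2 : e <= 1 / 2 by rewrite ge_min lexx orbT.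
pose V := [set M : 'M[R]_(d, i) | l1norm (plucker M0 - plucker M) < e * p M0].
pose W := (frames : set 'M[R]_(d, i)) `&` V.
have oV : open V.
  have cf : continuous (fun M : 'M[R]_(d, i) => l1norm (plucker M0 - plucker
    M)).
    apply: continuous_l1norm => M.
    have h := @cvgB R _ 'M[R]_(d, i) (nbhs M) _ _ _ _ _ (cvg_cst (plucker M0))
      (@continuous_plucker R 'M[R]_(d, i) i d (fun M => M) (fun=> cvg_id) M).
    exact: h.
  by apply: (@open_comp _ _ _ [set x : R | x < e * p M0]) => //; exact: open_lt.
have oW : open W by apply: openI => //; exact: open_frames.
have WM0 : W M0 by split=> //; rewrite /V /= subrr l1norm0 mulr_gt0.
have oI : open (sp @` W) by apply: open_span_of_image => // M [].
have IE : (sp @` W) E by exists M0.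
have [F [[A [E' [SA [Q [M [Qn fM cM ME']]]]] eqF] [M' WM' M'F]]] :=
  clE _ (open_nbhs_nbhs (conj oI IE)).
have uA := hGL SA.
pose a : Sigma := exist _ A (mem_set SA).
have fQM : frames (wp Q *m M) by apply: frames_mull => //;
  exact: word_prod_unit.
have FE : F = sp (wp (a :: Q) *m M).
  rewrite /= -mulmxA; exact: act_inj_frame uA fQM (esym ME') eqF.
have [fM' VM'] := WM'.
have faQM : frames (wp (a :: Q) *m M) by apply: frames_mull => //;
  exact: word_prod_unit.
(* [F] is given by two frames; their transition matrix [g] is moved into [M], which [cone_mulr]
   allows. *)
have [g ug M'E] : exists2 g, g \in unitmx & M' = wp (a :: Q) *m M *m g.
  by apply: (span_of_eq (E0 := E0)) => //; rewrite M'F FE.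
rewrite /interior /= nbhsE; exists (sp @` W); first by split.
move=> _ [M2 [fM2 VM2] <-].
apply: (@multicone_perturb a Q (M *m g) M2) => //.
- exact: frames_mulr.
- exact: cone_mulr.
rewrite mulmxA -M'E.
have t1 : l1norm (plucker M' - plucker M2) <=
    l1norm (plucker M0 - plucker M') + l1norm (plucker M0 - plucker M2).
  rewrite (l1normB (plucker M0) (plucker M'));
    apply: le_trans (ler_l1normD _ _).
  by rewrite addrA subrK.
have t2 : p M0 <= p M2 + l1norm (plucker M0 - plucker M2).
  apply: le_trans (ler_l1normD _ _).
  by rewrite addrC subrK.
move: VM' VM2; rewrite /V /= => VM' VM2.
have t3 : e * p M0 <= 1 / 2 * p M0 by rewrite ler_wpM2r // ltW.
have t4 : 4 * e * p M2 <= eta * p M2 by rewrite ler_wpM2r ?l1norm_ge0.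
have t5 : e * p M0 <= e * (2 * p M2).
  by rewrite ler_wpM2l ?(ltW e0) //; lra.
lra.
Qed.

(** The norm of the compound is, up to [i!], the sum of the Pluecker norms of the images of the
    coordinate frames, so the best of these reaches the average. One factor [D] comes from
    averaging, the other from the norm of a coordinate frame. *)
Lemma coordinate_frame (A : 'M[R]_d) :
  let D : R := #|{: {ffun 'I_i -> 'I_d}}|%:R in
  A \in unitmx ->
  exists M, [/\ 0 < p (A *m M) & D ^- 2 * (l1norm (compound i A) * p M) <= p (A
    *m M)].
Proof.
move=> D uA; have id : (i <= d)%N by move: hi => /andP[]; lia.
pose e b : 'M[R]_(d, i) := colsub (multi b) 1%:M.
have mulAe b : A *m e b = colsub (multi b) A.
  apply/matrixP => x y; rewrite !mxE (bigD1 (multi b y)) //= !mxE eqxx mulr1.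
  by rewrite big1 ?addr0 // => j jb; rewrite !mxE (negPf jb) mulr0.
have NE : l1norm (compound i A) = i`!%:R^-1 * \sum_b p (A *m e b).
  rewrite /l1norm exchange_big mulr_sumr; apply: eq_bigr => b _.
  rewrite /plucker_norm /l1norm mulr_sumr; apply: eq_bigr => a _.
  rewrite big_ord1 !mxE normrM normfV [ `|_%:R|]ger0_norm //;
    congr (_ * `|\det _|).
  by rewrite mulAe; apply/matrixP => x y; rewrite !mxE.
have N0 : 0 < l1norm (compound i A) by rewrite l1norm_gt0 (compound_unit_neq0
  hi).
pose f0 : {ffun 'I_i -> 'I_d} := [ffun x => widen_ord id x].
have fact0 : 0 < i`!%:R :> R by rewrite ltr0n fact_gt0.
have D0 : 0 < D by rewrite ltr0n; apply/card_gt0P; exists f0.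
have [b _ bmax] := @Order.TotalTheory.arg_maxP _ _ _ (enum_rank f0) xpredT
  (fun b => p (A *m e b)) isT.
have sum_le : \sum_b p (A *m e b) <= D * p (A *m e b).
  rewrite mulr_natl -[X in _ *+ X]card_ord -sumr_const; apply: ler_sum => c _.
  exact: bmax.
have pe : p (e b) <= D * i`!%:R.
  have := @l1norm_le_const R _ _ i`!%:R (plucker (e b)) _.
  rewrite muln1; apply=> x y; rewrite mxE; apply: det_le_fact => u v;
    rewrite !mxE.
  by case: (_ == _); rewrite ?normr1 ?normr0.
have sumE : \sum_b p (A *m e b) = i`!%:R * l1norm (compound i A).
  by rewrite NE mulVKf // gt_eqF.
rewrite sumE in sum_le.
exists (e b); split.
  by rewrite -(pmulr_rgt0 _ D0); apply: lt_le_trans sum_le; rewrite mulr_gt0.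
rewrite mulrC ler_pdivrMr ?exprn_gt0 //.
apply: (@le_trans _ _ (l1norm (compound i A) * (D * i`!%:R))).
  by rewrite ler_wpM2l // ltW.
rewrite (_ : _ * (D * _) = D * (i`!%:R * l1norm (compound i A))); last by ring.
rewrite (_ : _ * D ^+ 2 = D * (D * p (A *m e b))); last by ring.
by rewrite ler_wpM2l // ltW.
Qed.

Lemma tau_small e : 0 < e -> exists2 m, (0 < m)%N & C * tau ^+ m < e.
Proof.
move=> e0; have [m hm] : exists m, tau ^+ m < e / (C + 1).
  apply: expr_small; first by rewrite ltW //=; case/andP: tau01.
  by rewrite divr_gt0 // ltr_wpDl.
exists m.+1 => //; have C1 : 0 < C + 1 by rewrite ltr_wpDl.
apply: (@le_lt_trans _ _ (tau ^+ m * (C + 1))); last by rewrite -ltr_pdivlMr.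
rewrite mulrC ler_pM ?exprn_ge0 ?(ltW tau0) //; last by rewrite lerDl.
by rewrite exprS ler_piMl ?exprn_ge0 ?(ltW tau0) //; case/andP: tau01 => _ /ltW.
Qed.

(** The bound [D ^- 2] of [coordinate_frame] does not depend on the word, so a long power of one
    letter sends some frame into the cone of threshold [delta / 2]. *)
Lemma multicone_nonempty (a : Sigma) : multicone !=set0.
Proof.
pose D : R := #|{: {ffun 'I_i -> 'I_d}}|%:R.
have D0 : 0 < D ^- 2.
  rewrite invr_gt0 exprn_gt0 // ltr0n; apply/card_gt0P.
  have id : (i <= d)%N by move: hi => /andP[]; lia.
  by exists [ffun x => widen_ord id x].
have [m m0 hm] : exists2 m, (0 < m)%N & C * tau ^+ m < D ^- 2 * (delta / 12).
  by apply: tau_small; rewrite mulr_gt0 // divr_gt0.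
pose Q := nseq m a.
have sQ : size Q = m by rewrite size_nseq.
have [M [pM cM]] := coordinate_frame (word_prod_unit hGL Q).
have Q0 : (0 < size Q)%N by rewrite sQ.
have cQ := cone_contract Q0 D0 cM.
have fM : frames (wp Q *m M).
  by apply: frames_plucker; rewrite -l1norm_gt0.
exists (sp (wp Q *m M)), [::], (wp Q *m M); split=> //; last by rewrite mul1mx.
apply: cone_le cQ; rewrite /c_ mul0r subr0 sQ.
have : 6 * (C * tau ^+ m) / D ^- 2 <= delta / 2.
  by rewrite ler_pdivrMr //; move: hm; lra.
lra.
Qed.

(** If a plane of the multicone met the kernel, the functional would annihilate its Pluecker vector
    and [P] would expand it by at most [C * tau ^+ m * N P]; the cone condition for the longer word
    [P ++ Q] forces at least [delta / 4 * delta * N P]. As [m] depends on neither [Q] nor [M], one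
    complement serves all planes. *)
Lemma multicone_transverse (a : Sigma) : exists F : Grass R (d - i) d,
  forall E, multicone E -> transverse E F.
Proof.
have [m m0 hm] : exists2 m, (0 < m)%N & C * tau ^+ m < delta / 4 * delta.
  by apply: tau_small; rewrite mulr_gt0 // divr_gt0.
pose P := nseq m a.
have sP : size P = m by rewrite size_nseq.
have P0 : (0 < size P)%N by rewrite sP.
have [x [L [fL hL]]] := N_approx P0; rewrite sP in hL.
have [F FL] := kernel_plane fL.
exists F => _ [Q [M [Qn fM cM <-]]].
have fQM : frames (wp Q *m M) by apply: frames_mull => //;
  exact: word_prod_unit.
apply: (kernel_transverse E0 fQM FL); apply/eqP => det0.
have pl0 : coplucker L *m plucker (wp Q *m M) = 0.
  by rewrite coplucker_plucker det0 mulr0 raddf0.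
set S := _ - _ in hL.
have up : p (wp P *m (wp Q *m M)) <= C * tau ^+ m * N P * p (wp Q *m M).
  rewrite /plucker_norm plucker_mul.
  have -> : compound i (wp P) = S + x *m coplucker L by rewrite /S subrK.
  rewrite mulmxDl -[x *m _ *m _]mulmxA pl0 mulmx0 addr0.
  by apply: le_trans (l1normM _ _) _; rewrite ler_wpM2r ?l1norm_ge0.
have c4 : cone (delta / 4) M by apply: cone_le cM; apply: c_ge; exact: ltnW.
have low := c4 (P ++ Q); rewrite word_prod_cat -mulmxA in low.
have pQ : 0 < p (wp Q *m M) by exact: plucker_norm_gt0.
have pQM : p (wp Q *m M) <= N Q * p M by exact: plucker_norm_mul.
have NP := N_gt0 P.
have h1 : delta / 4 * delta * (N P * p (wp Q *m M)) <=
    delta / 4 * (N (P ++ Q) * p M).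
  rewrite -mulrA ler_wpM2l ?divr_ge0 ?(ltW d0) //.
  apply: (@le_trans _ _ (delta * (N P * N Q) * p M)).
    by rewrite -!mulrA ler_wpM2l ?(ltW d0) // ler_wpM2l // ltW.
  by rewrite ler_wpM2r ?l1norm_ge0.
have h2 : C * tau ^+ m * (N P * p (wp Q *m M)) <
    delta / 4 * delta * (N P * p (wp Q *m M)).
  by rewrite ltr_pM2r // mulr_gt0.
have := le_lt_trans (le_trans h1 (le_trans low up));
  rewrite -mulrA => /(_ _ h2).
by rewrite ltxx.
Qed.

End ConeConstruction.

(** * Sets of directions and the final choice of the invariant sets *)

Section Assembly.
Context {R : realType}.

Lemma Grass_inhabited k d : (k <= d)%N -> exists E : Grass R k d, True.
Proof.
move=> kd; pose J : 'M[R]_(d, k) := pid_mx k.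
have fJ : frames J.
  by apply/frames_gram;
    rewrite tr_pid_mx mul_pid_mx minnn (minn_idPr kd) pid_mx_1
    det1 oner_neq0.
by exists (plane_of_frame (exist _ J (mem_set fJ))).
Qed.

(** Any set between [K] and [O] is strictly invariant: its images stay in the closed [K]. This
    leaves room to choose one with finitely many components, here and among directions. *)
Lemma invariant_neighbourhood (d i : nat) (Sigma : set 'M[R]_d) :
  (1 <= i <= d - 1)%N -> (forall A, Sigma A -> A \in unitmx) ->
  compact Sigma -> dominated i Sigma ->
  exists (O K : set (Grass R i d)) (F : Grass R (d - i) d),
    [/\ closed K, K !=set0, star Sigma O `<=` K, K `<=` O°
      & forall E, O E -> transverse E F].
Proof.
move=> hi hGL hcompact hdom.
have id : (i <= d)%N by move: hi => /andP[]; lia.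
have [E0 _] := Grass_inhabited id.
(* An empty [Sigma] offers no letter to start from; then the planes projecting isomorphically onto
   the first [i] coordinates form a suitable neighbourhood of the coordinate plane. *)
have [[A0 SA0]|/set0P/negP/negPn/eqP S0] := pselect (Sigma !=set0); last first.
  pose J : 'M[R]_(d, i) := pid_mx i.
  have JJ : J^T *m J = 1%:M.
    by rewrite /J tr_pid_mx mul_pid_mx minnn (minn_idPr id) pid_mx_1.
  have fJ : frames J by apply/frames_gram; rewrite JJ det1 oner_neq0.
  have rJ : row_free J^T by apply/row_freeP; exists J.
  have [F FJ] := kernel_plane rJ.
  pose W := (frames : set 'M[R]_(d, i)) `&` [set M | \det (J^T *m M) != 0].
  have oW : open W.
    apply: openI; first exact: open_frames.
    apply: (@open_comp _ _ (fun M : 'M[R]_(d, i) => \det (J^T *m M)) [set x : R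
      | x != 0]);
      last exact: open_neq.
    move=> M _; apply: continuous_det; apply: continuous_mulmx.
      exact: cst_continuous.
    by move=> ?; exact: cvg_id.
  have WJ : W J by split=> //; rewrite /= JJ det1 oner_neq0.
  have oO : open (span_of E0 @` W) by apply: open_span_of_image => // M [].
  exists (span_of E0 @` W), [set span_of E0 J], F; split.
  - apply: accessible_closed_set1; apply: hausdorff_accessible.
    exact: Grass_hausdorff E0.
  - by exists (span_of E0 J).
  - by move=> E [A [E' [+ _ _]]]; rewrite S0.
  - by move=> _ ->; apply: open_nbhs_nbhs; split=> //; exists J.
  - by move=> _ [M [fM dM] <-]; exact: (kernel_transverse E0 fM FJ).
pose a0 : Sigma := exist _ A0 (mem_set SA0).
have [K [C [tau [delta [[K1 C0 tau01 delta01] [Nle Ninv Nsup Napp]]]]]] :=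
  word_growth hi hGL hcompact hdom.
have d0 : 0 < delta by case/andP: delta01.
have [n n0 hn] : exists2 n, (0 < n)%N & C * tau ^+ n < (delta / 4) ^+ 2 / 6.
  by apply: tau_small => //; rewrite divr_gt0 // exprn_gt0 // divr_gt0.
have n_large : 6 * (C * tau ^+ n) <= (delta / 4) ^+ 2.
  by move: hn; rewrite ltr_pdivlMr // mulrC => /ltW.
pose O := @multicone R d i Sigma delta n E0.
have inv : strictly_invariant Sigma O.
  exact: (multicone_strictly_invariant hi hGL K1 C0 tau01 delta01 Nle Ninv Nsup
    Napp n0 n_large).
have [F OF] : exists F : Grass R (d - i) d, forall E, O E -> transverse E F.
  exact: (multicone_transverse hi hGL C0 tau01 delta01 Nsup Napp n0 E0 a0).
have [E OE] : O !=set0.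
  exact: (multicone_nonempty hi hGL K1 C0 tau01 delta01 Nsup Napp n0 n_large E0
    a0).
exists O, (closure (star Sigma O)), F; split=> //.
- exact: closed_closure.
- have [M fM ME] := span_of_surj E0 E.
  exists (span_of E0 (A0 *m M)); apply: subset_closure.
  by exists A0, E; split=> //; rewrite plane_span_mull ?ME //; exact: hGL.
- exact: subset_closure.
Qed.

(** If [v0 = M0 *m a] and [b *m a = 1], the matrix [M0 + (v - v0) *m b] varies continuously with [v]
    and its column space contains [v]; so a line near one contained in a plane of [U] lies in a
    nearby plane, still in [U]. *)
Lemma directions_open (d i : nat) (U : set (Grass R i d)) : (1 <= d)%N ->
  (i <= d)%N -> open U -> open [set L : Grass R 1 d | exists2 E, U E &
    directions E L].
Proof.
move=> d1 id oU; have [L0 _] := Grass_inhabited d1;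
  have [E0 _] := Grass_inhabited id.
pose W : set 'M[R]_(d, 1) := [set v | frames v /\ exists2 E, U E & v \in plane
  E].
have spv (v : 'M[R]_(d, 1)) (V : {vspace 'cV[R]_d}) : frames v ->
    (plane (span_of L0 v) <= V)%VS <-> v \in V.
  move=> fv; split=> [/subvP|vV].
    by apply; apply/(mem_span_of _ _ fv); exists 1%:M; rewrite mulmx1.
  apply/subvP => u /(mem_span_of _ _ fv)[k ->].
  by rewrite [k]mx11_scalar mul_mx_scalar memvZ.
have -> : [set L : Grass R 1 d | exists2 E, U E & directions E L] = span_of L0
  @` W.
  apply/seteqP; split=> [L [E UE LE]|_ [v [fv [E UE vE]] <-]].
    have [v fv vL] := span_of_surj L0 L; exists v => //; split=> //.
    by exists E => //; apply/(spv v _ fv); rewrite vL.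
  by exists E => //; apply/(spv v _ fv).
apply: open_span_of_image; last by move=> v [].
rewrite openE => v0 [fv0 [E UE v0E]].
have [M0 fM0 M0E] := span_of_surj E0 E.
have [a aE] : exists a : 'cV[R]_i, v0 = M0 *m a.
  by apply/(mem_span_of E0 _ fM0); rewrite M0E.
have fa : a^T *m a \in unitmx.
  rewrite unitmxE unitfE; apply/(frames_gram (a : 'M[R]_(i, 1)));
    apply/framesP => k ak.
  by have /framesP := fv0; apply; rewrite aE -mulmxA ak mulmx0.
pose b := invmx (a^T *m a) *m a^T.
have ba : b *m a = 1%:M by rewrite /b -mulmxA mulVmx.
pose phi (v : 'M[R]_(d, 1)) := M0 + (v - v0) *m b.
have phia v : phi v *m a = v.
  by rewrite /phi mulmxDl -aE -mulmxA ba mulmx1 addrC subrK.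
have cphi : continuous phi.
  move=> v; have cB : continuous (fun v : 'M[R]_(d, 1) => (v - v0) *m b).
    apply: continuous_mulmx; last exact: cst_continuous.
    move=> u; have h := @cvgB R _ 'M[R]_(d, 1) (nbhs u) _ _ _ _ _ cvg_id
      (cvg_cst v0).
    exact: h.
  have h := @cvgD R _ 'M[R]_(d, 1) (nbhs v) _ _ _ _ _ (cvg_cst M0) (cB v).
  exact: h.
have phi0 : phi v0 = M0 by rewrite /phi subrr mul0mx addr0.
pose X := (frames : set 'M[R]_(d, 1)) `&`
  phi @^-1` [set M : 'M[R]_(d, i) | frames M /\ U (span_of E0 M)].
have oX : open X.
  apply: openI; first exact: open_frames.
  by apply: open_comp => [? _|]; [exact: cphi | exact: open_span_of_preimage].
rewrite /interior nbhsE; exists X.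
  by split=> //; split=> //; rewrite /preimage /= phi0 M0E.
move=> v [fv [fphi Uphi]]; split=> //; exists (span_of E0 (phi v)) => //.
by apply/(mem_span_of _ _ fphi); exists a; rewrite phia.
Qed.

(** Closedness comes from compactness: orthonormal frames of planes in [K] applied to unit
    coordinate vectors form a compact set of unit vectors representing all these directions. *)
Lemma directions_closed (d i : nat) (K : set (Grass R i d)) : (1 <= d)%N ->
  (i <= d)%N -> closed K ->
  closed [set L : Grass R 1 d | exists2 E, K E & directions E L].
Proof.
move=> d1 id clK; have [L0 _] := Grass_inhabited d1;
  have [E0 _] := Grass_inhabited id.
have [B [cB Bo BK]] := span_of_orthonormal_preimage E0 clK.
pose f (x : 'M[R]_(d, i) * 'M[R]_(i, 1)) : 'M[R]_(d, 1) := x.1 *m x.2.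
pose B1 := f @` (B `*` orthonormal_mx).
have cB1 : compact B1.
  apply: continuous_compact; last by apply: compact_setX => //;
    exact: orthonormal_mx_compact.
  apply: continuous_subspaceT; apply: continuous_mulmx => x;
    [exact: cvg_fst|exact: cvg_snd].
have oB1 : B1 `<=` orthonormal_mx.
  move=> _ [[M a] [/= /Bo MM aa] <-]; rewrite /orthonormal_mx /f /=.
  by rewrite trmx_mul mulmxA -(mulmxA _ M^T) MM mulmx1.
have -> : [set L : Grass R 1 d | exists2 E, K E & directions E L] = span_of L0
  @` B1.
  apply/seteqP; split=> [L [E KE LE]|_ [_ [[M a] [/= BM aa] <-] <-]].
    have [v ov vL] := span_of_orthonormal L0 L.
    move: KE; rewrite -BK => -[M BM ME].
    have fM : frames M by exact/orthonormal_mx_frames/Bo.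
    have fv : frames v by exact: orthonormal_mx_frames.
    have [k kE] : exists k : 'cV[R]_i, v = M *m k.
      apply/(mem_span_of E0 _ fM); rewrite ME; apply: (subvP LE); rewrite -vL.
      by apply/(mem_span_of _ _ fv); exists 1%:M; rewrite mulmx1.
    exists v => //; exists (M, k) => //; split=> //=.
    by have := ov; rewrite /orthonormal_mx /= kE trmx_mul mulmxA -(mulmxA _
      M^T) (Bo _ BM) mulmx1.
  exists (span_of E0 M); first by rewrite -BK; exists M.
  have fM : frames M by exact/orthonormal_mx_frames/Bo.
  have fMa : frames (f (M, a)) by apply/orthonormal_mx_frames/oB1;
    exists (M, a).
  apply/subvP => u /(mem_span_of _ _ fMa)[k ->]; apply/(mem_span_of _ _ fM).
  by exists (a *m k); rewrite mulmxA.
apply: compact_closed; first exact: Grass_hausdorff L0.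
by apply: span_of_compact => //; apply: subset_trans oB1 _;
  exact: orthonormal_mx_frames.
Qed.

End Assembly.

Theorem mainTheorem3 (R : realType) (d i : nat) (hi : (1 <= i <= d - 1)%N)
    (Sigma : set 'M[R]_d) (hGL : forall A, Sigma A -> A \in unitmx)
    (hcompact : compact Sigma) (hdom : dominated i Sigma) :
  (exists C : set (Grass R i d),
    [/\ C !=set0,
        strictly_invariant Sigma C,
        exists F : Grass R (d - i) d, forall E, C E -> transverse E F
      & finitely_many_separated_components C]) /\
  (exists C' : set (Grass R 1 d),
    [/\ strictly_invariant Sigma C',
        exists E : Grass R i d, directions E `<=` C',
        exists F : Grass R (d - i) d, C' `&` directions F = set0
      & finitely_many_separated_components C']).
Proof.
have id : (i <= d)%N by move: hi => /andP[]; lia.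
have d1 : (1 <= d)%N by move: hi => /andP[]; lia.
have [E0 _] := @Grass_inhabited R _ _ id;
  have [L0 _] := @Grass_inhabited R _ _ d1.
have [U [K [F [clK [E1 KE1] UK KU UF]]]] := invariant_neighbourhood hi hGL
  hcompact hdom.
split.
  have [C [KC CO fC]] := Grass_finite_components E0 clK (open_interior U) KU.
  have CO' := subset_trans CO (@interior_subset _ U).
  exists C; split=> //.
  - by exists E1; apply: interior_subset; exact: KC.
  - apply: subset_trans KC; rewrite [X in _ `<=` X](closure_id _).1 //.
    apply: closureS; apply: subset_trans UK => H [A [E [SA CE HE]]].
    by exists A, E; split=> //; exact: CO'.
  - by exists F => E /CO'; exact: UF.
(* The interior of [U] and the closed set [K] are replaced by the directions contained in their
   planes, and the same sandwich is repeated. *)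
pose O1 := [set L : Grass R 1 d | exists2 E, U° E & directions E L].
pose K1 := [set L : Grass R 1 d | exists2 E, K E & directions E L].
have oO1 : open O1 by apply: directions_open => //; exact: open_interior.
have clK1 : closed K1 by exact: directions_closed.
have KO1 : K1 `<=` O1 by move=> L [E KE LE]; exists E => //; exact: KU.
have [C [KC CO fC]] := Grass_finite_components L0 clK1 oO1 KO1.
exists C; split=> //.
- apply: subset_trans KC; rewrite [X in _ `<=` X](closure_id _).1 //.
  apply: closureS => L' [A [L [SA /CO[E OE LE] L'E]]].
  (* [A] carries a direction of [E] into the plane [act A (plane E)], which belongs to [K] because
     [E] lies in [U]. *)
  have [M fM ME] := span_of_surj E0 E.
  have AME := plane_span_mull E0 fM (hGL _ SA).
  exists (span_of E0 (A *m M)).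
    apply: UK; exists A, E; split=> //; first exact: interior_subset.
    by rewrite AME ME.
  by rewrite /directions /= L'E AME ME; exact: limgS.
- by exists E1 => L LE; apply: interior_subset; apply: KC; exists E1.
- exists F; apply/seteqP; split=> // L [/CO[E OE LE] LF].
  have EF := UF E (interior_subset OE).
  have : (plane L <= 0)%VS by rewrite -EF subv_cap; apply/andP; split.
  rewrite subv0 => /eqP L0'; have := svalP L; rewrite -/(plane L) L0'.
  by rewrite dimv0.
Qed.
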